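(* Let the smooth component $f$ of the problem $F^\star=\min_{x\in Q}\{F(x)=f(x)+\psi(x)\}$ be Quasi-Self-Concordant with parameter $M>0$, and let $x^\star$ be a solution. Let the parameters $R$, $A_0$, $\gamma$ be chosen as $$R\ge\max\Bigl\{\|x_0-x^\star\|,\frac{2^{3/2}}{M}\Bigr\},\qquad A_0=\frac{c^2R^2}{2(F(x_0)-F^\star)},\qquad\gamma=\frac1{(MR)^{2/3}},$$ for some absolute constant $c>0$. Let $0<\varepsilon<1$. Then the number $k$ of iterations of the Accelerated Newton Scheme described in the context to reach the relative accuracy $F(x_k)-F^\star\le\varepsilon\,(F(x_0)-F^\star)$ is bounded as $$k\ \le\ O\Bigl((MR)^{2/3}\cdot\ln\frac1\varepsilon\Bigr).$$ The total number of iterations of the inner Dual Newton Method is bounded as $$\sum_{i=1}^kI_i\ \le\ O\Bigl((MR)^{2/3}\cdot\ln\frac1\varepsilon\cdot\mathcal L\Bigr),$$ where $$\mathcal L=\ln\Bigl[\frac{(MR)^{2/3}R}{F(x_0)-F^\star}\cdot\bigl(\sqrt{L_{f,1}\mathcal F_0}+L_{\psi,0}\bigr)\cdot\frac1\varepsilon\ln^2\frac1\varepsilon\Bigr],$$ $I_i$ is the number of (outer) iterations of the Dual Newton Method performed at the $i$-th iteration of the scheme, $O(\cdot)$ hides absolute constants, and $L_{f,1}$, $L_{\psi,0}$, $\mathcal F_0$ are defined in the context.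
   Context: $\mathbb{E}$ is a finite-dimensional real vector space with dual $\mathbb{E}^*$; $\langle s,x\rangle$ denotes the value of $s\in\mathbb{E}^*$ at $x\in\mathbb{E}$. A self-adjoint positive-definite operator $B:\mathbb{E}\to\mathbb{E}^*$ is fixed, with norms $\|h\|=\langle Bh,h\rangle^{1/2}$ on $\mathbb{E}$, $\|s\|_*=\langle s,B^{-1}s\rangle^{1/2}$ on $\mathbb{E}^*$, and the induced operator norm for operators $\mathbb{E}\to\mathbb{E}^*$. Problem: $F^\star=\min_{x\in Q}\{F(x)=f(x)+\psi(x)\}$, where $\psi:\mathbb{E}\to\mathbb{R}\cup\{+\infty\}$ is a simple closed convex proper function, $Q=\operatorname{dom}\psi$, and $f:Q\to\mathbb{R}$ is convex and several times differentiable, with gradient $\nabla f(x)$, Hessian $\nabla^2f(x)\succeq0$ and third derivative $D^3f(x)$ (a symmetric trilinear form). A solution of the problem exists. $f$ is Quasi-Self-Concordant with parameter $M$ if $D^3f(x)[u,u,v]\le M\langle\nabla^2f(x)u,u\rangle\|v\|$ for all $x$ in the domain of $f$ and all $u,v\in\mathbb{E}$. $\partial$ denotes the convex subdifferential. Dual Newton Method $\mathscr D(\hat f,\hat\psi,\hat x_0,\hat M,\nu)$, for $\hat F=\hat f+\hat\psi$ on $Q$: initialize $g_0=\|\hat F'(\hat x_0)\|_*$ for some $\hat F'(\hat x_0)\in\partial\hat F(\hat x_0)$. For $j\ge0$ iterate: (1) set $z_0=\hat x_j$; (2) for $t\ge0$ iterate: (2-a) $z_{t+1}=\arg\min_{y\in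 Q}\{\langle\nabla\hat f(z_t),y-z_t\rangle+\frac12\langle\nabla^2\hat f(z_t)(y-z_t),y-z_t\rangle+\hat Mg_j\|y-\hat x_j\|^2+\hat\psi(y)\}$; (2-b) $s_{t+1}=\nabla\hat f(z_{t+1})-\nabla\hat f(z_t)-\nabla^2\hat f(z_t)(z_{t+1}-z_t)$; until $\|s_{t+1}\|_*\le\frac{2\hat Mg_j\nu}{(j+1)^2}$; (3) set $\hat x_{j+1}=z_{t+1}$ and $g_{j+1}=\|s_{t+1}-2\hat Mg_jB(\hat x_{j+1}-\hat x_j)\|_*$ (the norm of a subgradient in $\partial\hat F(\hat x_{j+1})$); (4) if $g_{j+1}\le\nu$, return $\hat x_{j+1}$. Accelerated Newton Scheme: choose $x_0\in Q$, $R>0$, $A_0>0$, $\gamma\in(0,1)$, and set $v_0=x_0$. For $k\ge0$ iterate: (1) $A_{k+1}=\frac1{1-\gamma}A_k$, $a_{k+1}=\frac\gamma{1-\gamma}A_k$, $\nu_{k+1}=\frac R{(k+1)^2}$; (2) $\bar f_k(x)=A_{k+1}f(\gamma x+(1-\gamma)x_k)$ and $\bar\psi_k(x)=a_{k+1}\psi(x)+\frac12\|x-v_k\|^2$; (3) $v_{k+1}=\mathscr D(\bar f_k,\bar\psi_k,v_k,\gamma M,\nu_{k+1})$; (4) $x_{k+1}=\gamma v_{k+1}+(1-\gamma)x_k$. Constants: $L_{f,1}=\max\{\|\nabla^2f(x)\|:x\in Q,\ \|x-x^\star\|\le(5+c)R\}$; $L_{\psi,0}=\max\{\|\psi'(x)\|_*:x\in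 Q,\ \psi'(x)\in\partial\psi(x),\ \|x-x^\star\|\le(5+c)R\}$; $\mathcal F_0=\max\{F(x)-F^\star:x\in Q,\ \|x-x^\star\|\le(5+c)R\}$.
   Formalization: Each logarithm in the bounds (both ln(1/ε) and the outer one in 𝓛) is read as max{1, ln}, because the literal bounds fail as ε→1, where k≥1 but ln(1/ε)→0 and 𝓛→−∞; for ε≤1/e nothing changes. *)

(* Defs.v *)
From mathcomp Require Import all_boot all_order all_algebra.
From mathcomp Require Import all_classical all_reals all_analysis.

Set Implicit Arguments.
Unset Strict Implicit.
Unset Printing Implicit Defensive.

Import Order.TTheory GRing.Theory Num.Theory.
Import numFieldNormedType.Exports.

Local Open Scope classical_set_scope.
Local Open Scope ring_scope.

(** The space E is R^n, as row vectors. Its dual E* is also represented by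
    ['rV[R]_n], through the pairing below, and an operator A : E -> E* by the
    matrix acting on the right, h |-> h *m A. A self-adjoint operator is then
    a symmetric matrix. *)

Definition pair_dual (R : realType) (n : nat) (s x : 'rV[R]_n) : R :=
  \sum_(i < n) s 0 i * x 0 i.

Notation "''<' s , x >" := (pair_dual s x)
  (at level 8, s at level 9, x at level 9, format "''<' s ,  x >") : ring_scope.

Definition self_adjoint_posdef (R : realType) (n : nat) (B : 'M[R]_n) : Prop :=
  B^T = B /\ forall h : 'rV[R]_n, h != 0 -> 0 < '<(h *m B), h>.

Definition pnorm (R : realType) (n : nat) (B : 'M[R]_n) (h : 'rV[R]_n) : R :=
  Num.sqrt '<(h *m B), h>.

Definition dnorm (R : realType) (n : nat) (B : 'M[R]_n) (s : 'rV[R]_n) : R :=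
  Num.sqrt '<s, (s *m invmx B)>.

Definition opnorm (R : realType) (n : nat) (B A : 'M[R]_n) : R :=
  sup [set dnorm B (h *m A) | h in [set h : 'rV[R]_n | pnorm B h <= 1]].

(** Derivatives of functions E -> R. *)

Definition grad (R : realType) (n : nat) (f : 'rV[R]_n -> R) (x : 'rV[R]_n) :
    'rV[R]_n :=
  \row_i 'D_(delta_mx 0 i) f x.

Definition hess (R : realType) (n : nat) (f : 'rV[R]_n -> R) (x : 'rV[R]_n) :
    'M[R]_n :=
  jacobian (grad f) x.

Definition D3 (R : realType) (n : nat) (f : 'rV[R]_n -> R)
    (x u v w : 'rV[R]_n) : R :=
  'D_w (fun y => '<(u *m hess f y), v>) x.

(** [Q] need not be open: being differentiable on [Q] means being so on an
    open neighbourhood of [Q]; values of [f] outside of it are irrelevant. *)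
Definition thrice_differentiable_on (R : realType) (n : nat)
    (Q : set 'rV[R]_n) (f : 'rV[R]_n -> R) : Prop :=
  exists U : set 'rV[R]_n, [/\ open U, Q `<=` U &
    forall x, U x -> [/\ differentiable f x, differentiable (grad f) x &
                         differentiable (hess f) x]].

Definition quasi_self_concordant (R : realType) (n : nat) (B : 'M[R]_n)
    (Q : set 'rV[R]_n) (M : R) (f : 'rV[R]_n -> R) : Prop :=
  forall x u v : 'rV[R]_n, Q x ->
    D3 f x u u v <= M * '<(u *m hess f x), u> * pnorm B v.

(** Convex analysis of functions E -> R U {+oo}. *)

Definition edom (R : realType) (n : nat) (h : 'rV[R]_n -> \bar R) :
    set 'rV[R]_n :=
  [set x | (h x < +oo)%E].

Definition closed_convex_proper (R : realType) (n : nat)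
    (h : 'rV[R]_n -> \bar R) : Prop :=
  [/\ forall x, (-oo < h x)%E,
      edom h !=set0,
      lower_semicontinuous h &
      forall (x y : 'rV[R]_n) (t : R), 0 <= t <= 1 ->
        (h (t *: x + (1 - t) *: y)%R <= t%:E * h x + (1 - t)%:E * h y)%E].

Definition subdiff (R : realType) (n : nat) (h : 'rV[R]_n -> \bar R)
    (x : 'rV[R]_n) : set 'rV[R]_n :=
  [set s | h x \is a fin_num /\
           forall y, (h x + ('<s, (y - x)>)%:E <= h y)%E].

Definition is_argmin (R : realType) (n : nat) (h : 'rV[R]_n -> \bar R)
    (x : 'rV[R]_n) : Prop :=
  edom h x /\ forall y, (h x <= h y)%E.

Definition is_max (R : realType) (S : set R) (m : R) : Prop :=
  S m /\ ubound S m.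

(** f + psi; it is +oo outside of dom psi, whatever the values of f there. *)
Definition composite (R : realType) (n : nat) (f : 'rV[R]_n -> R)
    (psi : 'rV[R]_n -> \bar R) (x : 'rV[R]_n) : \bar R :=
  ((f x)%:E + psi x)%E.

Section DualNewtonMethod.
Variables (R : realType) (n : nat) (B : 'M[R]_n).
Variables (f : 'rV[R]_n -> R) (psi : 'rV[R]_n -> \bar R).
Variables (x0 : 'rV[R]_n) (M nu : R).

(** The function of y minimized at step (2-a), where z = z_t, x = x_j and
    g = g_j; minimizing over dom psi is minimizing over E. *)
Definition newton_model (z x : 'rV[R]_n) (g : R) (y : 'rV[R]_n) : \bar R :=
  (('<(grad f z), (y - z)> + 2^-1 * '<((y - z) *m hess f z), (y - z)>
    + M * g * pnorm B (y - x) ^+ 2)%:E + psi y)%E.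

Definition newton_residual (z z' : 'rV[R]_n) : 'rV[R]_n :=
  grad f z' - grad f z - (z' - z) *m hess f z.

Definition inner_stop (j : nat) (g : R) (z z' : 'rV[R]_n) : Prop :=
  dnorm B (newton_residual z z') <= 2 * M * g * nu / j.+1%:R ^+ 2.

(** [z 0, ..., z T.+1] is a completed inner loop: it stops exactly after
    iteration t = T. *)
Definition inner_loop (j : nat) (x : 'rV[R]_n) (g : R)
    (z : nat -> 'rV[R]_n) (T : nat) : Prop :=
  [/\ z 0%N = x,
      forall t, (t <= T)%N -> is_argmin (newton_model (z t) x g) (z t.+1),
      forall t, (t < T)%N -> ~ inner_stop j g (z t) (z t.+1) &
      inner_stop j g (z T) (z T.+1)].

Definition dual_newton_iteration (j : nat) (x : 'rV[R]_n) (g : R)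
    (x' : 'rV[R]_n) (g' : R) : Prop :=
  exists (z : nat -> 'rV[R]_n) (T : nat),
    [/\ inner_loop j x g z T,
        x' = z T.+1 &
        g' = dnorm B (newton_residual (z T) (z T.+1)
                      - (2 * M * g) *: ((x' - x) *m B))].

(** A completed run, started with the subgradient [s0] of f + psi at [x0],
    which performs exactly [I] outer iterations and returns [out]. *)
Definition dual_newton_run (s0 : 'rV[R]_n) (I : nat) (out : 'rV[R]_n) : Prop :=
  exists (x : nat -> 'rV[R]_n) (g : nat -> R),
    [/\ x 0%N = x0,
        subdiff (composite f psi) x0 s0 /\ g 0%N = dnorm B s0,
        forall j, (j < I)%N ->
          dual_newton_iteration j (x j) (g j) (x j.+1) (g j.+1),
        forall j, (0 < j < I)%N -> nu < g j &
        [/\ (0 < I)%N, g I <= nu & out = x I]].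

End DualNewtonMethod.

Section AcceleratedNewtonScheme.
Variables (R : realType) (n : nat) (B : 'M[R]_n).
Variables (f : 'rV[R]_n -> R) (psi : 'rV[R]_n -> \bar R).
Variables (M : R) (x0 : 'rV[R]_n) (Rad A0 gamma : R).

Definition scheme_A (k : nat) : R := iter k (fun A => (1 - gamma)^-1 * A) A0.

Definition scheme_a (k : nat) : R := gamma / (1 - gamma) * scheme_A k.-1.

Definition scheme_nu (k : nat) : R := Rad / k%:R ^+ 2.

Definition scheme_f (k : nat) (xk x : 'rV[R]_n) : R :=
  scheme_A k.+1 * f (gamma *: x + (1 - gamma) *: xk).

Definition scheme_psi (k : nat) (vk x : 'rV[R]_n) : \bar R :=
  ((scheme_a k.+1)%:E * psi x + (2^-1 * pnorm B (x - vk) ^+ 2)%:E)%E.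

(** The runs of the Dual Newton Method which iteration [k] may perform: the
    only freedom is the choice of the initial subgradient [s]. *)
Definition scheme_inner_run (k : nat) (xk vk s : 'rV[R]_n) (I : nat)
    (out : 'rV[R]_n) : Prop :=
  dual_newton_run B (scheme_f k xk) (scheme_psi k vk) vk (gamma * M)
    (scheme_nu k.+1) s I out.

(** The first [K] iterations of the scheme; [I i] is the number of iterations
    of the Dual Newton Method at the [i]-th one, [1 <= i <= K]. *)
Definition scheme_run (K : nat) (x v : nat -> 'rV[R]_n) (I : nat -> nat) :
    Prop :=
  [/\ x 0%N = x0, v 0%N = x0 &
      forall k, (k < K)%N ->
        (exists s, scheme_inner_run k (x k) (v k) s (I k.+1) (v k.+1)) /\
        x k.+1 = gamma *: v k.+1 + (1 - gamma) *: x k].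

(** The scheme is never stuck: after any number K of completed iterations the
    Dual Newton Method terminates from every initial subgradient, and such a
    subgradient exists (when K = 0, this is a condition on the choice of
    [x0]). *)
Definition scheme_well_defined : Prop :=
  forall (K : nat) (x v : nat -> 'rV[R]_n) (I : nat -> nat),
    scheme_run K x v I ->
    let S := subdiff (composite (scheme_f K (x K)) (scheme_psi K (v K))) (v K)
    in
    ((0 < K)%N -> S !=set0) /\
    (forall s, S s -> exists (J : nat) (out : 'rV[R]_n),
       scheme_inner_run K (x K) (v K) s J out).

End AcceleratedNewtonScheme.

Section Constants.
Variables (R : realType) (n : nat) (B : 'M[R]_n).
Variables (f : 'rV[R]_n -> R) (psi : 'rV[R]_n -> \bar R).
Variables (xs : 'rV[R]_n) (r : R).

Definition dom_ball : set 'rV[R]_n :=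
  [set x | edom psi x /\ pnorm B (x - xs) <= r].

Definition is_Lf1 : R -> Prop :=
  is_max [set opnorm B (hess f x) | x in dom_ball].

Definition is_Lpsi0 : R -> Prop :=
  is_max [set l | exists x s, [/\ dom_ball x, subdiff psi x s & l = dnorm B s]].

Definition is_calF0 : R -> Prop :=
  is_max [set fine (composite f psi x) - fine (composite f psi xs)
         | x in dom_ball].

End Constants.

(** The usual convention for logarithms inside O(.). The floor 1 is needed: as
    eps tends to 1, ln (1 / eps) tends to 0, but at least one iteration is
    performed. *)
Definition lnO (R : realType) (y : R) : R := Num.max 1 (ln y).

(* Main.v *)
From HB Require Import structures.
Require Import Defs.
From mathcomp Require Import all_boot all_order all_algebra.
From mathcomp Require Import all_classical all_reals all_analysis.
From mathcomp Require Import ring lra.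

Set Implicit Arguments.
Unset Strict Implicit.
Unset Printing Implicit Defensive.

Import Order.TTheory GRing.Theory Num.Theory.
Import numFieldNormedType.Exports.

Local Open Scope classical_set_scope.
Local Open Scope ring_scope.

(** The objective of subproblem k of the scheme is [A_{k+1} f] composed with a
    homothety of ratio gamma, plus [psi] and a quadratic prox term. It is
    1-strongly convex, and its smooth part is quasi-self-concordant with
    parameter [gamma M] ([qsc_pullback]). Three facts give the theorem.

    First, a potential. Let [V_k = 2 A_k (F(x_k) - F(xs)) + |v_k - xs|^2].
    Strong convexity of the subproblem yields ([scheme_progress])
      [|v_{k+1} - v_k|^2 + V_{k+1} - V_k <= 2 nu_{k+1} |v_{k+1} - xs|].
    As the tolerances [nu_k] sum to at most 2R, such a perturbed Fejer sequence
    satisfies [V_k <= ((5 + c) R)^2], and the displacements [|v_{k+1} - v_k|]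
    have a square sum of the same order ([fejer_bound], [run_potential]). The
    iterates remain in the ball where the constants are defined, and since
    [A_k] grows by the factor [1 / (1 - gamma)] the gap decays geometrically:
    this is the bound on the number of iterations ([gap_decay]).

    Second, a Newton step. Quasi-self-concordance bounds the residual of a
    Newton step by M times its squared length in the Hessian form
    ([newton_residual_le]); with the regularization [M g |. - x|^2] the residual
    is divided by 8 at each inner step ([newton_step_decay]). Inner loops
    therefore terminate, and an outer iteration of the Dual Newton Method is an
    inexact proximal step with coefficient [2 M g_j].

    Third, the number of proximal steps. By the Fejer inequality again, the
    displacements [r_j] have a square sum of order [D^2], with D the distance to
    the minimizer, whereas [g_{j+1}] is at most about [2 M r_j g_j]. As
    [a <= exp (a - 1)], the product of N factors [4 M^2 r_j^2] is at most
    [exp (O (M^2 D^2) - N)], so that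
      [N <= O (M^2 D^2) + 2 ln (g_0 / nu)]
    iterations reach the tolerance nu ([dual_newton_run_spec]).

    In subproblem k the parameter is [gamma M], and D is [|v_{k+1} - v_k|] up to
    a multiple of the tolerance. Summing over k and using
    [(gamma M R)^2 = (M R)^(2/3)], the terms in [D^2] contribute
    [O ((M R)^(2/3))] in total rather than at each iteration. Only the logarithm
    of [g_0 / nu] is paid each time; it is of the order of the stated one, since
    [g_0] is at most [gamma A_{k+1}] times
    [2 L_{psi,0} + (5 + c) R L_{f,1}] and the weights [A_{k+1}] are bounded as
    long as the accuracy is not reached ([start_ratio_le]). *)

(** * The dual pairing and the norms *)

Section Pairing.
Context {R : realType} {n : nat}.
Implicit Types (s t u v x : 'rV[R]_n) (A : 'M[R]_n) (a : R).

Lemma pairE s x : '<s, x> = (s *m x^T) 0 0.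
Proof. by rewrite mxE; apply: eq_bigr => i _; rewrite mxE. Qed.

Lemma pairC s x : '<s, x> = '<x, s>.
Proof. by apply: eq_bigr => i _; rewrite mulrC. Qed.

Lemma pairDl s t x : '<(s + t), x> = '<s, x> + '<t, x>.
Proof. by rewrite !pairE mulmxDl mxE. Qed.

Lemma pairZl a s x : '<(a *: s), x> = a * '<s, x>.
Proof. by rewrite !pairE -scalemxAl mxE. Qed.

Lemma pairNl s x : '<(- s), x> = - '<s, x>.
Proof. by rewrite -scaleN1r pairZl mulN1r. Qed.

Lemma pairBl s t x : '<(s - t), x> = '<s, x> - '<t, x>.
Proof. by rewrite pairDl pairNl. Qed.

Lemma pairDr s x y : '<s, (x + y)> = '<s, x> + '<s, y>.
Proof. by rewrite pairC pairDl !(pairC s). Qed.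

Lemma pairZr a s x : '<s, (a *: x)> = a * '<s, x>.
Proof. by rewrite pairC pairZl (pairC s). Qed.

Lemma pairNr s x : '<s, (- x)> = - '<s, x>.
Proof. by rewrite pairC pairNl (pairC s). Qed.

Lemma pairBr s x y : '<s, (x - y)> = '<s, x> - '<s, y>.
Proof. by rewrite pairDr pairNr. Qed.

Lemma pair0l x : '<0, x> = 0.
Proof. by rewrite pairE mul0mx mxE. Qed.

Lemma pair0r s : '<s, 0> = 0.
Proof. by rewrite pairC pair0l. Qed.

Lemma pair_mulmx A u v : '<(u *m A), v> = '<u, (v *m A^T)>.
Proof. by rewrite !pairE trmx_mul trmxK mulmxA. Qed.

Lemma pair_delta s i : '<s, (delta_mx 0 i)> = s 0 i.
Proof.
rewrite /pair_dual (bigD1 i) //= mxE !eqxx mulr1 big1 ?addr0 // => j ji.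
by rewrite mxE eqxx /= (negPf ji) mulr0.
Qed.

Lemma pair_ext s t : (forall u, '<s, u> = '<t, u>) -> s = t.
Proof. by move=> st; apply/rowP => i; rewrite -!pair_delta st. Qed.

End Pairing.

Definition pairLR := (@pairDl, @pairBl, @pairNl, @pairZl, @pairDr, @pairBr,
  @pairNr, @pairZr, @mulmxDl, @mulmxBl, @mulNmx).

Section Geometry.
Context {R : realType} {n : nat} {B : 'M[R]_n}.
Hypothesis hB : self_adjoint_posdef B.
Implicit Types (s t u v x h : 'rV[R]_n) (a c : R).

Lemma ipC u v : '<(u *m B), v> = '<(v *m B), u>.
Proof. by rewrite pair_mulmx hB.1 pairC. Qed.

Lemma ip_ge0 h : 0 <= '<(h *m B), h>.
Proof.
have [->|h0] := eqVneq h 0; first by rewrite pair0r.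
by apply/ltW; exact: hB.2.
Qed.

Lemma sqr_pnorm h : pnorm B h ^+ 2 = '<(h *m B), h>.
Proof. by rewrite sqr_sqrtr // ip_ge0. Qed.

Lemma pnorm_ge0 h : 0 <= pnorm B h.
Proof. exact: sqrtr_ge0. Qed.

Lemma dnorm_ge0 s : 0 <= dnorm B s.
Proof. exact: sqrtr_ge0. Qed.

Lemma pnorm_gt0 h : h != 0 -> 0 < pnorm B h.
Proof. by move=> h0; rewrite sqrtr_gt0 hB.2. Qed.

Lemma pnorm0 : pnorm B 0 = 0.
Proof. by rewrite /pnorm pair0r sqrtr0. Qed.

Lemma pnorm_eq0 h : pnorm B h = 0 -> h = 0.
Proof. by move=> h0; apply: contraPeq h0 => /pnorm_gt0 /lt0r_neq0/eqP. Qed.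

Lemma ip_le u v : '<(u *m B), v> <= pnorm B u * pnorm B v.
Proof.
have [->|u0] := eqVneq u 0; first by rewrite mul0mx pair0l pnorm0 mul0r.
have [->|v0] := eqVneq v 0; first by rewrite pair0r pnorm0 mulr0.
have a0 := pnorm_gt0 u0; have b0 := pnorm_gt0 v0.
have := ip_ge0 (pnorm B v *: u - pnorm B u *: v).
rewrite !pairLR -!scalemxAl !pairLR -!sqr_pnorm (ipC v u) => H.
have {}H : 0 <= 2 * (pnorm B u * pnorm B v) *
   (pnorm B u * pnorm B v - '<(u *m B), v>) by nra.
by move: H; rewrite pmulr_rge0 ?subr_ge0 // mulr_gt0 // mulr_gt0.
Qed.

Lemma pnormZ a h : pnorm B (a *: h) = `|a| * pnorm B h.
Proof.
rewrite /pnorm -scalemxAl pairZl pairZr mulrA -expr2 sqrtrM ?sqr_ge0 //.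
by rewrite sqrtr_sqr.
Qed.

Lemma pnormN h : pnorm B (- h) = pnorm B h.
Proof. by rewrite -scaleN1r pnormZ normrN1 mul1r. Qed.

Lemma pnorm_distC u v : pnorm B (u - v) = pnorm B (v - u).
Proof. by rewrite -opprB pnormN. Qed.

Lemma pnormD u v : pnorm B (u + v) <= pnorm B u + pnorm B v.
Proof.
rewrite -(@ler_pXn2r _ 2) ?nnegrE ?addr_ge0 ?pnorm_ge0 //.
rewrite sqr_pnorm !pairLR -!sqr_pnorm (ipC v u).
by have := ip_le u v; nra.
Qed.

Lemma posdef_unitmx : B \in unitmx.
Proof.
rewrite -row_free_unit -kermx_eq0; apply/eqP/row_matrixP => i; rewrite row0.
apply: contrapT => /eqP k0; have := hB.2 _ k0.
by rewrite -row_mul mulmx_ker row0 pair0l ltxx.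
Qed.

Lemma dnormE s : dnorm B s = pnorm B (s *m invmx B).
Proof. by rewrite /pnorm mulmxKV ?posdef_unitmx. Qed.

Lemma pair_le s x : '<s, x> <= dnorm B s * pnorm B x.
Proof. by rewrite -{1}(mulmxKV posdef_unitmx s) dnormE ip_le. Qed.

Lemma dnorm_mulB h : dnorm B (h *m B) = pnorm B h.
Proof. by rewrite dnormE mulmxK ?posdef_unitmx. Qed.

Lemma dnormZ a s : dnorm B (a *: s) = `|a| * dnorm B s.
Proof. by rewrite !dnormE -scalemxAl pnormZ. Qed.

Lemma dnormN s : dnorm B (- s) = dnorm B s.
Proof. by rewrite !dnormE mulNmx pnormN. Qed.

Lemma dnormD s t : dnorm B (s + t) <= dnorm B s + dnorm B t.
Proof. by rewrite !dnormE mulmxDl pnormD. Qed.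

Lemma dnormB s t : dnorm B (s - t) <= dnorm B s + dnorm B t.
Proof. by rewrite (le_trans (dnormD _ _)) ?dnormN. Qed.

Lemma dnorm_eq0 s : dnorm B s = 0 -> s = 0.
Proof.
rewrite dnormE => /pnorm_eq0 s0.
by rewrite -(mulmxKV posdef_unitmx s) s0 mul0mx.
Qed.

(** The dual norm is the least constant of the pairing: the supremum is reached
    at the vector representing [s] for the scalar product of [B]. *)
Lemma dnorm_le s c : 0 <= c -> (forall u, '<s, u> <= c * pnorm B u) ->
  dnorm B s <= c.
Proof.
move=> c0 /(_ (s *m invmx B)); rewrite -dnormE.
have -> : '<s, (s *m invmx B)> = dnorm B s ^+ 2.
  by rewrite dnormE sqr_pnorm mulmxKV ?posdef_unitmx.
have := dnorm_ge0 s; rewrite le_eqVlt => /predU1P[<- //|s0].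
by rewrite expr2 ler_pM2r.
Qed.

Lemma coord_le h i : `|h 0 i| <= `|h|.
Proof.
have /mapP[j Hj ->] : `|h 0 i| \in [seq `|h x.1 x.2| | x : 'I_1 * 'I_n].
  by apply/mapP; exists (ord0, i) => //=; rewrite mem_enum.
by rewrite [leRHS]/Num.Def.normr /= mx_normrE; apply/bigmax_geP; right => /=;
  exists j.
Qed.

Lemma norm_le_coord h c : 0 <= c -> (forall i, `|h 0 i| <= c) -> `|h| <= c.
Proof.
move=> c0 hc; rewrite [leLHS]/Num.Def.normr /= mx_normrE; apply/bigmax_leP;
  split=> //.
by move=> [i j] _ /=; rewrite (ord1 i).
Qed.

Lemma pair_le_norm s x : `|'<s, x>| <= (\sum_i `|s 0 i|) * `|x|.
Proof.
rewrite (le_trans (ler_norm_sum _ _ _)) // mulr_suml; apply: ler_sum => i _.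
by rewrite normrM ler_wpM2l // coord_le.
Qed.

(** The norm of [B] and the entrywise norm define the same topology. For this
    direction, each coordinate is the pairing with a basis vector, whose dual
    norm bounds it. *)
Lemma norm_le_pnorm : exists2 K : R, 0 < K & forall h, `|h| <= K * pnorm B h.
Proof.
pose e i : 'rV[R]_n := delta_mx 0 i.
exists (1 + \sum_i dnorm B (e i)) => [|h].
  by rewrite ltr_pwDl // sumr_ge0 // => i _; exact: dnorm_ge0.
have S0 : 0 <= \sum_i dnorm B (e i).
  by rewrite sumr_ge0 // => j _; exact: dnorm_ge0.
apply: norm_le_coord => [|i]; first by rewrite mulr_ge0 ?pnorm_ge0 ?addr_ge0.
have le1 : dnorm B (e i) <= 1 + \sum_i dnorm B (e i).
  rewrite (bigD1 i) //= -subr_ge0 addrCA addrAC subrr add0r.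
  by rewrite addr_ge0 // sumr_ge0 // => j _; exact: dnorm_ge0.
apply: le_trans (ler_wpM2r (pnorm_ge0 _) le1).
rewrite -pair_delta pairC ler_norml pair_le andbT.
by rewrite lerNl -pairNr -(pnormN h) pair_le.
Qed.

Lemma pnorm_le_norm : exists2 K : R, 0 < K & forall h, pnorm B h <= K * `|h|.
Proof.
pose b := \sum_j \sum_i `|B i j|.
have b0 : 0 <= b by do 2!(apply: sumr_ge0 => ? _).
exists (1 + b) => [|h]; first by rewrite ltr_pwDl.
rewrite -(@ler_pXn2r _ 2) ?nnegrE ?mulr_ge0 ?pnorm_ge0 ?addr_ge0 //.
rewrite sqr_pnorm (@le_trans _ _ (b * `|h| ^+ 2)) //; last first.
  by rewrite exprMn ler_wpM2r ?sqr_ge0 //; nra.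
apply: le_trans (ler_norm _) _; apply: (le_trans (pair_le_norm _ _)).
rewrite expr2 mulrA ler_wpM2r // /b mulr_suml ler_sum // => j _.
rewrite mxE (le_trans (ler_norm_sum _ _ _)) // mulr_suml ler_sum // => i _.
by rewrite normrM mulrC ler_wpM2l // coord_le.
Qed.

End Geometry.

(** * Differentials of linear maps and symmetry of second derivatives *)

Section LinearMaps.
Context {R : realType}.

(** A linear map is determined by its values on the elementary matrices, and the
    sum of the norms of these values is a Lipschitz constant. *)
Lemma mx_linear_continuous (m n : nat) (W : normedModType R)
  (f : {linear 'M[R]_(m, n) -> W}) : continuous f.
Proof.
apply: bounded_linear_continuous; apply/linear_boundedP.
exists (\sum_i \sum_j `|f (delta_mx i j)|); split; first exact: num_real.
move=> r /ltW Cr A; apply: le_trans (ler_wpM2r (normr_ge0 A) Cr).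
rewrite [X in f X]matrix_sum_delta linear_sum mulr_suml.
rewrite (le_trans (ler_norm_sum _ _ _)) // ler_sum // => i _.
rewrite linear_sum mulr_suml (le_trans (ler_norm_sum _ _ _)) // ler_sum // => j
  _.
rewrite linearZ normrZ mulrC ler_wpM2l //.
rewrite [leRHS]/Num.Def.normr /= mx_normrE; apply/bigmax_geP; right => /=.
by exists (i, j).
Qed.

Lemma mx_linear_differentiable (m n : nat) (W : normedModType R)
  (f : {linear 'M[R]_(m, n) -> W}) A : differentiable f A.
Proof. exact/linear_differentiable/mx_linear_continuous. Qed.

Lemma mx_diff_linear (m n : nat) (W : normedModType R)
  (f : {linear 'M[R]_(m, n) -> W}) A : 'd f A = f :> (_ -> _).
Proof. exact/diff_lin/mx_linear_continuous. Qed.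

Lemma differentiable_linear_comp (V W : normedModType R) (m n : nat)
    (l : {linear 'M[R]_(m, n) -> W}) (G : V -> 'M[R]_(m, n)) x :
  differentiable G x -> differentiable (l \o G) x.
Proof.
by move=> dG; apply: differentiable_comp => //; exact: mx_linear_differentiable.
Qed.

Lemma derive_linear_comp (V W : normedModType R) (m n : nat)
    (l : {linear 'M[R]_(m, n) -> W}) (G : V -> 'M[R]_(m, n)) x v :
  differentiable G x -> 'D_v (l \o G) x = l ('d G x v).
Proof.
move=> dG; rewrite deriveE; last exact: differentiable_linear_comp.
rewrite diff_comp //=; last exact: mx_linear_differentiable.
by rewrite mx_diff_linear.
Qed.

Variable n : nat.
Implicit Types s u v x : 'rV[R]_n.

Definition pairl u s := '<s, u>.

Lemma pairl_linear u : linear (pairl u).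
Proof. by move=> a s t; rewrite /pairl pairDl pairZl. Qed.

HB.instance Definition _ u :=
  GRing.isLinear.Build R 'rV[R]_n R _ (pairl u) (pairl_linear u).

Definition bilin_at u v (A : 'M[R]_n) := '<(u *m A), v>.

Lemma bilin_at_linear u v : linear (bilin_at u v).
Proof.
by move=> a A C; rewrite /bilin_at mulmxDr -scalemxAr pairDl pairZl.
Qed.

HB.instance Definition _ u v :=
  GRing.isLinear.Build R 'M[R]_n R _ (bilin_at u v) (bilin_at_linear u v).

End LinearMaps.

Section Calculus.
Context {R : realType}.

(** This reduces estimates along a segment to real functions of one variable. *)
Lemma is_derive_line (V W : normedModType R) (g : V -> W) x h (t : R) :
  differentiable g (x + t *: h) ->
  is_derive t 1 (fun s : R => g (x + s *: h)) ('D_h g (x + t *: h)).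
Proof.
move=> /diff_derivable dg.
have E : (fun k => k^-1 *: (((fun s : R => g (x + s *: h)) \o shift t) (k *: 1)
                            - g (x + t *: h)))
       = (fun k => k^-1 *: ((g \o shift (x + t *: h)) (k *: h)
                            - g (x + t *: h))).
  apply/funext => k /=; congr (_ *: (g _ - _)).
  by rewrite -[k%:A]/(k * 1) mulr1 scalerDl addrCA.
have {dg} := dg h; rewrite /derivable => dg.
by split; rewrite /derivable /derive E.
Qed.

Lemma diff_remainder (V W : normedModType R) (G : V -> W) x (e : R) :
  differentiable G x -> 0 < e ->
  \forall h \near (0 : V), `|G (x + h) - G x - 'd G x h| <= e * `|h|.
Proof.
move=> dG e0; have /eqaddoP /(_ e e0) := diff_locally dG.
apply: filterS => h /=.
rewrite -![(_ - _ : _ -> _) _]/(_ - _) -![(_ + _ : _ -> _) _]/(_ + _) /=.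
by rewrite opprD addrA [h + x]addrC.
Qed.

Lemma le_of_derive_le0 (f df : R -> R) (a b : R) : a <= b ->
  (forall t, a <= t <= b -> is_derive t 1 f (df t)) ->
  (forall t, a <= t <= b -> df t <= 0) -> f b <= f a.
Proof.
move=> ab fdf df0.
have cf : {within `[a, b], continuous f}.
  apply: derivable_within_continuous => t; rewrite in_itv /= => tab.
  by have [] := fdf t tab.
have ider t : t \in `]a, b[%R -> is_derive t 1 f (df t).
  by rewrite in_itv /= => /andP[/ltW a1 /ltW b1]; apply: fdf; rewrite a1.
have [t tab E] := MVT_segment ab ider cf.
by rewrite -subr_le0 E mulr_le0_ge0 ?subr_ge0 // df0.
Qed.

Lemma near0_ball (V : normedModType R) (P : V -> Prop) :
  (\forall h \near (0 : V), P h) ->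
    exists2 d : R, 0 < d & forall h, `|h| < d -> P h.
Proof.
move=> /nbhs_ballP[d /= d0 dP]; exists d => // h hd; apply: dP.
by rewrite -ball_normE /= sub0r normrN.
Qed.

Context {n : nat}.
Implicit Types u v x : 'rV[R]_n.

Let second_diff (g : 'rV[R]_n -> R) x u v (t : R) :=
  g (x + t *: v + t *: u) - g (x + t *: u) - (g (x + t *: v) - g x).

(** By the mean value theorem along [u], the second difference is [t] times a
    difference of [G] in the direction [v], which the differential of [G] at [x]
    gives up to [o(t)]. *)
Lemma second_difference (g : 'rV[R]_n -> R) (G : 'rV[R]_n -> 'rV[R]_n) x u v
    (e : R) :
  (\forall h \near (0 : 'rV[R]_n), differentiable g (x + h) /\
     forall w, 'D_w g (x + h) = '<(G (x + h)), w>) ->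
  differentiable G x -> 0 < e ->
  exists2 d : R, 0 < d & forall t, 0 < t < d ->
    `|second_diff g x u v t - t ^+ 2 * '<('d G x v), u>| <= e * t ^+ 2.
Proof.
move=> dg dG e0; set S := \sum_i `|u 0 i|.
have S0 : 0 <= S by rewrite sumr_ge0.
set N := `|u| + `|v|; have N0 : 0 <= N by rewrite addr_ge0.
have k0 : 0 < 2 * N * S + 1 by rewrite ltr_wpDl // !mulr_ge0.
(* two remainders, each at most e' N t and paired with u, must fit in e t *)
set e' := e / (2 * N * S + 1); have e'0 : 0 < e' by rewrite divr_gt0.
have [d d0 hd] := near0_ball (filterI dg (diff_remainder dG e'0)).
exists (d / (N + 1)); first by rewrite divr_gt0 // ltr_wpDl.
move=> t /andP[t0]; rewrite ltr_pdivlMr ?ltr_wpDl // => td.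
have small a b : 0 <= a <= t -> 0 <= b <= t ->
    `|a *: v + b *: u| <= N * t /\ `|a *: v + b *: u| < d.
  move=> /andP[a0 aT] /andP[b0 bT].
  have le1 : `|a *: v + b *: u| <= N * t.
    rewrite (le_trans (ler_normD _ _)) // !normrZ !ger0_norm // /N.
    by have := normr_ge0 u; have := normr_ge0 v; nra.
  by split=> //; apply: le_lt_trans le1 _; lra.
pose a (s : R) := g (x + t *: v + s *: u) - g (x + s *: u).
pose da (s : R) := '<(G (x + t *: v + s *: u) - G (x + s *: u)), u>.
have ada s : 0 <= s <= t -> is_derive s 1 a (da s).
  move=> st; rewrite /da pairBl.
  have tt : 0 <= t <= t by rewrite ltW /=.
  have zz : 0 <= (0 : R) <= t by rewrite lexx ltW.
  have [[d1 D1] _] := hd _ (small t s tt st).2.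
  have [[d2 D2] _] := hd _ (small 0 s zz st).2.
  rewrite scale0r add0r in d2 D2; rewrite addrA in d1 D1.
  by rewrite -D1 -D2; apply: is_deriveB; apply: is_derive_line.
have ca : {within `[0, t], continuous a}.
  apply: derivable_within_continuous => s; rewrite in_itv /= => st.
  by have [] := ada s st.
have ider s : s \in `]0, t[%R -> is_derive s 1 a (da s).
  by rewrite in_itv /= => /andP[/ltW a1 /ltW b1]; apply: ada; rewrite a1.
have [s] := MVT_segment (ltW t0) ider ca.
rewrite in_itv /= => st; rewrite /a !scale0r !addr0 subr0 => E.
rewrite /second_diff E /da.
have tt : 0 <= t <= t by rewrite ltW /=.
have zz : 0 <= (0 : R) <= t by rewrite lexx ltW.
have [n1 m1] := small t s tt st; have [n2 m2] := small 0 s zz st.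
have [_ r1] := hd _ m1; have [_ r2] := hd _ m2.
rewrite scale0r add0r in n2 r2; rewrite addrA in r1.
set r1' := _ - _ - _ in r1; set r2' := _ - _ - _ in r2.
have -> : G (x + t *: v + s *: u) - G (x + s *: u) =
    t *: 'd G x v + (r1' - r2').
  rewrite /r1' /r2' linearD !linearZ /= ; apply/rowP => i; rewrite !mxE; ring.
rewrite pairDl pairZl mulrDl.
have -> : t * '<('d G x v), u> * t = t ^+ 2 * '<('d G x v), u> by ring.
rewrite addrAC subrr add0r normrM (gtr0_norm t0) expr2 mulrA.
rewrite ler_pM2r //; rewrite pairC.
apply: (le_trans (pair_le_norm _ _)); rewrite -/S.
have rr : `|r1' - r2'| <= 2 * e' * (N * t).
  rewrite (le_trans (ler_normB _ _)) //.
  apply: le_trans (lerD r1 r2) _.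
  by nra.
apply: le_trans (ler_wpM2l S0 rr) _.
rewrite (_ : S * _ = (e' * (2 * N * S)) * t); last by ring.
rewrite ler_pM2r // /e' mulrAC ler_pdivrMr // ler_pM2l //; lra.
Qed.

(** The second difference is symmetric in [u] and [v], hence so is its
    second-order term. *)
Lemma schwarz (g : 'rV[R]_n -> R) (G : 'rV[R]_n -> 'rV[R]_n) x u v :
  (\forall h \near (0 : 'rV[R]_n), differentiable g (x + h) /\
     forall w, 'D_w g (x + h) = '<(G (x + h)), w>) ->
  differentiable G x -> '<('d G x u), v> = '<('d G x v), u>.
Proof.
move=> dg dG; apply/eqP; rewrite -subr_eq0 -normr_le0.
apply/ler_addgt0Pr => e e0; rewrite add0r.
have e20 : 0 < e / 2 by rewrite divr_gt0.
have [d1 d10 h1] := second_difference u v dg dG e20.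
have [d2 d20 h2] := second_difference v u dg dG e20.
pose t := Num.min d1 d2 / 2.
have m0 : 0 < Num.min d1 d2 by rewrite lt_min d10.
have t0 : 0 < t by rewrite divr_gt0.
have tm : t < Num.min d1 d2 by rewrite /t; lra.
have /andP[td1 td2] : (t < d1) && (t < d2) by rewrite -lt_min.
have {h1} := h1 t; rewrite t0 td1 => /(_ isT) h1.
have {h2} := h2 t; rewrite t0 td2 => /(_ isT) h2.
have E : second_diff g x u v t = second_diff g x v u t
  by rewrite /second_diff (addrAC x); ring.
rewrite -(ler_pM2l (exprn_gt0 2 t0)) -{1}(gtr0_norm (exprn_gt0 2 t0)) -normrM.
rewrite mulrBr.
have -> : t ^+ 2 * e = e / 2 * t ^+ 2 + e / 2 * t ^+ 2 by field.
rewrite -E in h2; apply: le_trans (lerD h1 h2).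
apply: le_trans (ler_normB _ _); rewrite le_eqVlt; apply/orP; left.
by apply/eqP; congr (`| _ |); ring.
Qed.

End Calculus.

(** * Convex functions, subgradients and minimizers *)

Section ConvexAnalysis.
Context {R : realType} {n : nat} {B : 'M[R]_n}.
Hypothesis hB : self_adjoint_posdef B.
Implicit Types (s u v x y z g h : 'rV[R]_n) (Q : set 'rV[R]_n)
  (p q : 'rV[R]_n -> R).

Definition segment_closed Q := forall x y (t : R), Q x -> Q y ->
  0 <= t <= 1 -> Q (x + t *: (y - x)).

(** Convexity with modulus [mu] in the norm of [B]; convexity is the case
    [mu = 0]. *)
Definition convex_mod (mu : R) Q p := forall x y (t : R), Q x -> Q y ->
  0 <= t <= 1 -> p (x + t *: (y - x)) <=
    p x + t * (p y - p x) - mu / 2 * (t * (1 - t)) * pnorm B (y - x) ^+ 2.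

Definition subgrad Q p x s := Q x /\ forall y, Q y ->
  p x + '<s, (y - x)> <= p y.

(** Lower semicontinuity of the function equal to [p] on [Q] and to [+oo]
    elsewhere. *)
Definition closed_sublevels Q p :=
  forall m : R, closed [set x | Q x /\ p x <= m].

Definition min_on Q p x := Q x /\ forall y, Q y -> p x <= p y.

Lemma addrKl (V : zmodType) (x h : V) : x + h - x = h.
Proof. by rewrite addrAC subrr add0r. Qed.

Lemma le_of_small_perturbation (a b c : R) :
  (forall t, 0 < t <= 1 -> a <= b + t * c) -> a <= b.
Proof.
move=> H; apply/ler_addgt0Pr => e e0.
have k0 : 0 < `|c| + e by rewrite ltr_wpDl.
have t0 : 0 < e / (`|c| + e) by rewrite divr_gt0.
have t1 : e / (`|c| + e) <= 1 by rewrite ler_pdivrMr // mul1r lerDr.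
apply: (le_trans (H (e / (`|c| + e)) _)); first by rewrite t0.
rewrite lerD2l (le_trans (ler_wpM2l (ltW t0) (ler_norm c))) //.
by rewrite mulrAC ler_pdivrMr // ler_pM2l // lerDl ltW.
Qed.

(** The step is at most 1 in order to stay inside a segment of a convex set. *)
Lemma derive_dir (W : normedModType R) (q : 'rV[R]_n -> W) x h (e : R) :
  differentiable q x -> 0 < e ->
  exists2 t : R, 0 < t <= 1 &
    forall r, 0 < r <= t -> `|q (x + r *: h) - q x - r *: 'D_h q x| <= r * e.
Proof.
move=> dq e0; have k0 : 0 < `|h| + 1 by rewrite ltr_wpDl.
have [d d0 hd] := near0_ball (diff_remainder dq (divr_gt0 e0 k0)).
have d'0 : 0 < d / (`|h| + 1) by rewrite divr_gt0.
exists (Num.min 1 (d / (`|h| + 1) / 2)).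
  by rewrite lt_min ltr01 divr_gt0 //= ge_min lexx.
move=> r /andP[r0]; rewrite le_min => /andP[r1 rd].
have {hd} := hd (r *: h); rewrite normrZ gtr0_norm // linearZ -deriveE //=.
move=> hd; apply: le_trans (hd _) _.
  have : r < d / (`|h| + 1) by lra.
  rewrite ltr_pdivlMr //; apply: le_lt_trans.
  by rewrite ler_pM2l // lerDl.
by rewrite mulrCA ler_pM2l // mulrAC ler_pdivrMr // ler_pM2l // lerDl.
Qed.

Lemma grad_derive q x h : differentiable q x -> 'D_h q x = '<(grad q x), h>.
Proof.
move=> dq; rewrite deriveE // {1}(row_sum_delta h) linear_sum /=.
by apply: eq_bigr => i _;
  rewrite linearZ /= mxE deriveE // -[_ *: _]/(_ * _) mulrC.
Qed.

Lemma convex_modD mu nu Q p q :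
  convex_mod mu Q p -> convex_mod nu Q q ->
  convex_mod (mu + nu) Q (fun x => p x + q x).
Proof.
move=> cp cq x y t Qx Qy t01.
by have := cp x y t Qx Qy t01; have := cq x y t Qx Qy t01; lra.
Qed.

Lemma convex_modZ mu (a : R) Q p : 0 <= a ->
  convex_mod mu Q p -> convex_mod (a * mu) Q (fun x => a * p x).
Proof.
move=> a0 cp x y t Qx Qy t01.
by have := ler_wpM2l a0 (cp x y t Qx Qy t01); lra.
Qed.

Lemma convex_mod_weak mu nu Q p : nu <= mu ->
  convex_mod mu Q p -> convex_mod nu Q p.
Proof.
move=> le cp x y t Qx Qy t01; apply: le_trans (cp x y t Qx Qy t01) _.
rewrite lerD2l lerN2; have /andP[t0 t1] := t01.
have k0 : 0 <= t * (1 - t) * pnorm B (y - x) ^+ 2.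
  by rewrite mulr_ge0 ?sqr_ge0 // mulr_ge0 ?subr_ge0.
by rewrite -!(mulrA (_ / 2)) ler_wpM2r // ler_pM2r.
Qed.

Lemma convex_mod_prox v Q :
  convex_mod 1 Q (fun x => 2^-1 * pnorm B (x - v) ^+ 2).
Proof.
move=> x y t _ _ _ /=; rewrite !(sqr_pnorm hB).
have -> : x + t *: (y - x) - v = (x - v) + t *: (y - x) by rewrite addrAC.
have -> : y - v = (x - v) + (y - x) by rewrite [RHS]addrC subrKA.
move: (x - v) (y - x) => a b.
by rewrite !pairLR -!scalemxAl !pairLR (ipC hB b a); rewrite le_eqVlt;
  apply/orP; left; apply/eqP; field.
Qed.

(** Compare the subgradient inequality at [x + t (y - x)] with strong convexity,
    divide by [t] and let [t] tend to 0. *)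
Lemma subgrad_strong mu Q p x s y :
  segment_closed Q -> convex_mod mu Q p -> subgrad Q p x s -> Q y ->
  p x + '<s, (y - x)> + mu / 2 * pnorm B (y - x) ^+ 2 <= p y.
Proof.
move=> sQ cp [Qx sx] Qy.
apply: (@le_of_small_perturbation _ _ (mu / 2 * pnorm B (y - x) ^+ 2)).
move=> t /andP[t0 t1]; have t01 : 0 <= t <= 1 by rewrite ltW.
have := sx _ (sQ _ _ _ Qx Qy t01); have := cp _ _ _ Qx Qy t01.
rewrite addrKl pairZr => H1 H2; have {}H1 := le_trans H2 H1.
rewrite -(ler_pM2l t0); nra.
Qed.

Lemma subgrad_monotone mu Q p x s y t :
  segment_closed Q -> convex_mod mu Q p -> subgrad Q p x s -> subgrad Q p y t ->
  mu * pnorm B (y - x) ^+ 2 <= '<(t - s), (y - x)>.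
Proof.
move=> sQ cp sx ty.
have H1 := subgrad_strong sQ cp sx ty.1; have H2 :=
  subgrad_strong sQ cp ty sx.1.
rewrite -(opprB y x) pairNr pnormN in H2; rewrite pairBl; lra.
Qed.

Lemma subgrad_grad mu Q q x : segment_closed Q -> 0 <= mu ->
  convex_mod mu Q q -> Q x -> differentiable q x -> subgrad Q q x (grad q x).
Proof.
move=> sQ mu0 cq Qx dq; split => // y Qy; apply/ler_addgt0Pr => e e0.
have [t tI ht] := derive_dir (y - x) dq e0; have /andP[t0 t1] := tI.
have t01 : 0 <= t <= 1 by rewrite ltW.
have := ht t; rewrite t0 lexx => /(_ isT); rewrite ler_norml => /andP[H _].
have c0 := convex_mod_weak mu0 cq.
have := c0 _ _ _ Qx Qy t01; rewrite mul0r !mul0r subr0 => H1.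
rewrite grad_derive // -[_ *: '<_, _> ]/(_ * _) in H.
rewrite -(ler_pM2l t0); nra.
Qed.

Lemma subgradD Q p q x s t :
  subgrad Q p x s -> subgrad Q q x t ->
    subgrad Q (fun x => p x + q x) x (s + t).
Proof.
move=> [Qx sx] [_ tx]; split => // y Qy.
by have := sx _ Qy; have := tx _ Qy; rewrite pairDl; lra.
Qed.

(** Optimality conditions are obtained by splitting off the smooth summand [q];
    the expansion of [q] is a hypothesis, so that quadratics need no
    computation of their gradient through differentials. *)
Lemma subgrad_split Q p q x s g : segment_closed Q -> convex_mod 0 Q p ->
  (forall y (e : R), Q y -> 0 < e -> exists2 t : R, 0 < t <= 1 &
     q (x + t *: (y - x)) <= q x + t * ('<g, (y - x)> + e)) ->
  subgrad Q (fun x => q x + p x) x s -> subgrad Q p x (s - g).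
Proof.
move=> sQ cp hq [Qx sx]; split => // y Qy; apply/ler_addgt0Pr => e e0.
have [t /[dup] tI /andP[t0 t1] H] := hq y e Qy e0.
have t01 : 0 <= t <= 1 by rewrite ltW.
have := cp _ _ _ Qx Qy t01; rewrite mul0r !mul0r subr0 => H1.
have := sx _ (sQ _ _ _ Qx Qy t01).
rewrite addrKl pairZr pairBl => H2.
rewrite -(ler_pM2l t0); nra.
Qed.

Lemma subgrad_split_diff Q p q x s : segment_closed Q -> convex_mod 0 Q p ->
  differentiable q x -> subgrad Q (fun x => q x + p x) x s ->
  subgrad Q p x (s - grad q x).
Proof.
move=> sQ cp dq; apply: subgrad_split => // y e Qy e0.
have [t tI ht] := derive_dir (y - x) dq e0; have /andP[t0 t1] := tI.
exists t => //; have := ht t; rewrite t0 lexx => /(_ isT).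
rewrite grad_derive // -[_ *: '<_, _> ]/(_ * _) ler_norml => /andP[_ H].
by rewrite mulrDr; lra.
Qed.

Lemma min_on_subgrad Q p x : min_on Q p x -> subgrad Q p x 0.
Proof. by move=> [Qx mx]; split => // y Qy; rewrite pair0l addr0 mx. Qed.

(** Outside of [Q], where nothing is known of [q], the affine minorant of [q]
    keeps the sum from being smaller than [p] by more than a local constant, so
    that limits of points of a sublevel set stay in [Q]. *)
Lemma closed_sublevelsD Q p q x0 g0 :
  closed_sublevels Q p -> subgrad Q q x0 g0 ->
  (forall x, Q x -> {for x, continuous q}) ->
  closed_sublevels Q (fun x => q x + p x).
Proof.
move=> cp [Qx0 sx0] cq m y Ay.
have near_le c : (\forall z \near y, Q z -> c <= q z) -> Q y /\ p y <= m - c.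
  move=> hc; apply: cp => V Vy.
  have [z [[Qz zm] [Vz zc]]] := Ay _ (filterI Vy hc).
  by exists z; split => //; split => //; have := zc Qz; lra.
have S0 : 0 <= \sum_i `|g0 0 i| by rewrite sumr_ge0.
have [Qy _] : Q y /\ p y <= m -
    (q x0 - (\sum_i `|g0 0 i|) * (1 + `|y - x0|)).
  apply: near_le; apply/nbhs_ballP; exists 1 => //= z;
    rewrite -ball_normE /= => yz Qz.
  apply: le_trans (sx0 _ Qz); rewrite lerD2l.
  have := pair_le_norm g0 (z - x0); rewrite ler_norml => /andP[+ _].
  apply: le_trans; rewrite lerN2 ler_wpM2l //.
  have -> : z - x0 = (z - y) + (y - x0) by rewrite subrKA.
  by rewrite (le_trans (ler_normD _ _)) // lerD2r distrC ltW.
split => //; apply/ler_addgt0Pr => e e0.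
have [|_] := near_le (q y - e); last by lra.
have /cvgrPdist_le /(_ e e0) := cq _ Qy.
by apply: filterS => z; rewrite ler_norml => /andP[_ ?] _; lra.
Qed.

Lemma subgrad_lower_bound (mu : R) Q p x s y :
  segment_closed Q -> 0 < mu -> convex_mod mu Q p -> subgrad Q p x s -> Q y ->
  p x - dnorm B s ^+ 2 / (2 * mu) <= p y.
Proof.
move=> sQ mu0 cp sx Qy; apply: le_trans (subgrad_strong sQ cp sx Qy).
have := pair_le hB s (- (y - x)); rewrite pairNr (pnormN) => H.
rewrite -addrA lerD2l lerNl ler_pdivlMr ?mulr_gt0 //.
by have := sqr_ge0 (mu * pnorm B (y - x) - dnorm B s); nra.
Qed.

(** Strong convexity bounds the diameter of a minimizing sequence. Its cluster
    points minimize because sublevel sets are closed. *)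
Lemma strongly_convex_min (mu : R) Q p a s :
  segment_closed Q -> 0 < mu -> convex_mod mu Q p -> closed_sublevels Q p ->
  subgrad Q p a s -> exists x, min_on Q p x.
Proof.
move=> sQ mu0 cp clp sa; have [Qa _] := sa.
have [m0 pm0] : exists m0, forall x, Q x -> m0 <= p x.
  by eexists => x; exact: (subgrad_lower_bound sQ mu0 cp sa).
pose m := inf (p @` Q).
have hi : has_inf (p @` Q).
  by split; [exists (p a), a | exists m0 => _ [x Qx <-]; exact: pm0].
have mle x : Q x -> m <= p x by move=> Qx; apply: (ge_inf hi.2); exists x.
have /choice[y hy] : forall k : nat, exists x, Q x /\ p x <= m + k.+1%:R^-1.
  move=> k; have k0 : 0 < k.+1%:R^-1 :> R by rewrite invr_gt0.
  have [_ [x Qx <-] lt] := inf_adherent k0 hi.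
  by exists x; split => //; exact: ltW.
pose A := [set x | Q x /\ p x <= m + 1].
have Ay k : A (y k).
  have [Qy yk] := hy k; split => //; apply: (le_trans yk); rewrite lerD2l.
  by rewrite invf_le1 // ler1n.
have compA : compact A.
  apply: bounded_closed_compact; last exact: clp.
  have [K K0 hK] := norm_le_pnorm hB.
  pose r := Num.sqrt (8 / mu).
  exists (K * r + `|y 0%N|); split; first exact: num_real.
  move=> b /ltW br x [Qx xm]; apply: le_trans br.
  have -> : x = (x - y 0%N) + y 0%N by rewrite subrK.
  apply: le_trans (ler_normD _ _) _; rewrite lerD2r (le_trans (hK _)) //.
  rewrite ler_pM2l // -[leLHS]ger0_norm ?pnorm_ge0 // -sqrtr_sqr ler_sqrt //.
    rewrite ler_pdivlMr //.
    have [Qy ym] := Ay 0%N.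
    have h01 : 0 <= (2^-1 : R) <= 1 by lra.
    have := cp (y 0%N) x 2^-1 Qy Qx h01.
    have := mle _ (sQ _ _ _ Qy Qx h01); move: (pnorm _ _ ^+ 2) => N.
    by move=> H1 H2; have := le_trans H1 H2; lra.
  by rewrite divr_ge0 // ltW.
have FA : (y @ \oo) A by exists 0%N => // k _; exact: Ay.
have [c [[Qc _] clc]] := compA _ _ FA.
exists c; split => // z Qz; apply: le_trans (mle _ Qz).
apply/ler_addgt0Pr => e e0.
have [_ //] : [set x | Q x /\ p x <= m + e] c.
apply: clp => V Vc; rewrite setIC.
suff Fe : \forall k \near \oo, [set x | Q x /\ p x <= m + e] (y k).
  by have [w [w1 w2]] := clc _ _ Fe Vc; exists w.
near=> k; have [Qy yk] := hy k; split => //; apply: (le_trans yk).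
rewrite lerD2l ltW //; near: k.
exact: near_infty_natSinv_lt (PosNum e0).
Unshelve. all: by end_near. Qed.

End ConvexAnalysis.

Arguments convex_mod {R n} B mu Q p.

(** * Quasi-self-concordant functions *)

Section Smooth.
Context {R : realType} {n : nat}.
Implicit Types (s u v w x y z h : 'rV[R]_n) (U Q : set 'rV[R]_n)
  (f : 'rV[R]_n -> R).

Lemma diff_grad f x u : 'd (grad f) x u = u *m hess f x.
Proof. by rewrite /hess /jacobian mul_rV_lin1. Qed.

Lemma nearU U x (P : 'rV[R]_n -> Prop) : open U -> U x ->
  (forall y, U y -> P y) -> \forall h \near (0 : 'rV[R]_n), P (x + h).
Proof.
move=> oU Ux UP; apply: (nbhs0P _ _).1.
have : nbhs x U by exact: open_nbhs_nbhs.
exact: filterS UP.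
Qed.

Lemma hess_sym_open U f x u v : open U -> U x ->
  (forall y, U y -> differentiable f y) -> differentiable (grad f) x ->
  '<(u *m hess f x), v> = '<(v *m hess f x), u>.
Proof.
move=> oU Ux df dg; rewrite -!diff_grad; apply: (@schwarz _ _ f) => //.
apply: (nearU (P := fun y => differentiable f y /\ forall w,
  'D_w f y = '<(grad f y), w>) oU Ux) => y Uy; split; first exact: df.
by move=> w; rewrite grad_derive //; exact: df.
Qed.

Lemma derive_grad f x u h : differentiable (grad f) x ->
  'D_h (pairl u \o grad f) x = '<(h *m hess f x), u>.
Proof. by move=> dg; rewrite derive_linear_comp //= diff_grad. Qed.

Lemma D3E f x u v w : differentiable (hess f) x ->
  D3 f x u v w = '<(u *m 'd (hess f) x w), v>.
Proof. exact: (@derive_linear_comp _ _ _ _ _ (bilin_at u v)). Qed.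

(** The third derivative is [D_w] of [u H v]; exchanging [v] and [w] is the
    symmetry of second derivatives for the function pairing the gradient with
    [u]. *)
Lemma D3_sym_open U f x u v w : open U -> U x ->
  (forall y, U y -> [/\ differentiable f y, differentiable (grad f) y &
                        differentiable (hess f) y]) ->
  D3 f x u v w = D3 f x u w v.
Proof.
move=> oU Ux df; have [_ _ dh] := df _ Ux.
have dG : differentiable (mulmx u \o hess f) x.
  exact: differentiable_linear_comp.
rewrite !D3E //; have dGE z : 'd (mulmx u \o hess f) x z = u *m 'd (hess f) x z.
  by rewrite -deriveE // derive_linear_comp.
rewrite -!dGE; apply: (@schwarz _ _ (pairl u \o grad f)) => //.
apply: (nearU (P := fun y => differentiable (pairl u \o grad f) y /\ forall w,
  'D_w (pairl u \o grad f) y = '<((mulmx u \o hess f) y), w>) oU Ux) => y Uy.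
have [dfy dgy dhy] := df _ Uy; split.
  exact: differentiable_linear_comp.
move=> z; rewrite derive_grad //=; apply: (hess_sym_open _ _ oU) => //.
by move=> y' /df[].
Qed.

End Smooth.

Section ScalarDerivatives.
Context {R : realType}.
Implicit Types (F : R -> R) (t c d : R).

Lemma is_derive_mulr_id c t : is_derive t 1 (fun s : R => s * c) c.
Proof.
have -> : (fun s : R => s * c) = ( *:%R^~ c) by [].
apply: (@is_derive_eq _ _ _ _ _ _ _ _ (DeriveDef _ erefl)).
  exact/derivable1_diffP.
by rewrite deriveE // diff_val scale1r.
Qed.

Lemma is_derive_sub_linear F d c t : is_derive t 1 F d ->
  is_derive t 1 (fun s : R => F s - s * c) (d - c).
Proof. by move=> dF; exact: (is_deriveB dF (is_derive_mulr_id c t)). Qed.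

Lemma is_derive_sub_quadratic F d c t : is_derive t 1 F d ->
  is_derive t 1 (fun s : R => F s - s ^+ 2 * c) (d - t * (2 * c)).
Proof.
move=> dF; have -> : (fun s : R => F s - s ^+ 2 * c) = F - (fun s : R => s * (s
  * c)).
  by apply/funext => s; rewrite expr2 -mulrA.
have -> : d - t * (2 * c) = d - (t * c + (t * c) * 1) by ring.
apply: (is_deriveB dF).
exact: (is_deriveM (is_derive_id t 1) (is_derive_mulr_id c t)).
Qed.

Lemma is_derive_damped F d t : is_derive t 1 F d ->
  is_derive t 1 (fun s : R => F s * (1 - s / 2)) (d * (1 - t / 2) - F t / 2).
Proof.
move=> dF; have -> : (fun s : R => F s * (1 - s / 2)) =
    F * ((cst 1 : R -> R) - (fun s : R => s / 2)) by [].
have -> : d * (1 - t / 2) - F t / 2 =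
   F t * (0 - 1 / 2) + (1 - t / 2) * d by field.
apply: (is_deriveM dF).
have d1 : is_derive t 1 (cst 1 : R -> R) 0 by exact: is_derive_cst.
rewrite mul1r; exact: (is_deriveB d1 (is_derive_mulr_id 2^-1 t)).
Qed.

Lemma undamp (t p q : R) : t <= 1 -> 0 <= p -> p * (1 - t / 2) <= q ->
  p <= 2 * q.
Proof. by nra. Qed.

Lemma ler_prod3 (m p a k : R) : 0 <= m -> 0 <= p -> a <= 2 * k ->
  m * a * p <= 2 * m * k * p.
Proof.
by move=> m0 p0 ak; rewrite ler_wpM2r // (mulrC 2) -mulrA ler_wpM2l.
Qed.

Lemma from_linear (p q t c : R) : p - t * c <= q - 0 * c -> p - q - t * c <= 0.
Proof. lra. Qed.

Lemma from_quadratic (p q b c : R) :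
  p - 1 * b - 1 ^+ 2 * c <= q - 0 * b - 0 ^+ 2 * c -> p - q - b <= c.
Proof. rewrite expr1n expr0n /=; lra. Qed.

Lemma half_prod3 (m k p : R) : 2 * m * k * p / 2 = m * k * p.
Proof. by field. Qed.

End ScalarDerivatives.

#[local] Opaque hess grad.

Section QuasiSelfConcordance.
Context {R : realType} {n : nat} {B : 'M[R]_n} {Q : set 'rV[R]_n}.
Context {f : 'rV[R]_n -> R} {M : R}.
Hypotheses (hB : self_adjoint_posdef B) (sQ : segment_closed Q).
Hypotheses (smf : thrice_differentiable_on Q f).
Implicit Types (s u v w x y z h : 'rV[R]_n).

Lemma smooth_diff x : Q x ->
  [/\ differentiable f x, differentiable (grad f) x & differentiable (hess f)
    x].
Proof. by have [U [_ QU dU]] := smf => /QU /dU. Qed.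

Lemma hess_sym x u v : Q x -> '<(u *m hess f x), v> = '<(v *m hess f x), u>.
Proof.
have [U [oU QU dU]] := smf => Qx; have [_ dg _] := smooth_diff Qx.
by apply: (hess_sym_open _ _ oU) => // [|y /dU[]//]; exact: QU.
Qed.

Lemma D3_sym x u v w : Q x -> D3 f x u v w = D3 f x u w v.
Proof.
by have [U [oU QU dU]] := smf => Qx; apply: (D3_sym_open _ _ _ oU) => //;
  exact: QU.
Qed.

Lemma is_derive_grad x h u (t : R) : Q (x + t *: h) ->
  is_derive t 1 (fun r : R => '<(grad f (x + r *: h)), u>)
    '<(h *m hess f (x + t *: h)), u>.
Proof.
move=> /smooth_diff[_ dg _]; rewrite -(derive_grad u h dg).
apply: (@is_derive_line _ _ _ (pairl u \o grad f) x h t).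
exact: differentiable_linear_comp.
Qed.

Lemma is_derive_hess x h u v (t : R) : Q (x + t *: h) ->
  is_derive t 1 (fun r : R => '<(u *m hess f (x + r *: h)), v>)
    (D3 f (x + t *: h) u v h).
Proof.
move=> /smooth_diff[_ _ dh].
apply: (@is_derive_line _ _ _ (bilin_at u v \o hess f) x h t).
exact: differentiable_linear_comp.
Qed.

Lemma dnorm_grad_le (L : R) x y : Q x -> Q y -> 0 <= L ->
  (forall t : R, 0 <= t <= 1 ->
     dnorm B ((y - x) *m hess f (x + t *: (y - x))) <= L * pnorm B (y - x)) ->
  dnorm B (grad f y - grad f x) <= L * pnorm B (y - x).
Proof.
move=> Qx Qy L0 hL; apply: dnorm_le => // [|u].
  by rewrite mulr_ge0 // pnorm_ge0.
set h := y - x; pose c := L * pnorm B h * pnorm B u.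
pose a (t : R) := '<(grad f (x + t *: h)), u> - t * c.
have : a 1 <= a 0.
  apply: (@le_of_derive_le0 _ a
    (fun t => '<(h *m hess f (x + t *: h)), u> - c) 0 1 ler01) => t t01.
    by apply/is_derive_sub_linear/is_derive_grad; exact: sQ.
  rewrite subr_le0 (le_trans (pair_le hB _ _)) // ler_wpM2r ?pnorm_ge0 //.
  exact: hL.
rewrite /a scale0r addr0 scale1r mul0r mul1r subr0 /h subrKC => H.
by rewrite pairBl -/h -/c; lra.
Qed.

Hypotheses (M0 : 0 < M) (qsc : quasi_self_concordant B Q M f).

(** Applying the bound on the third derivative to [v] and to [- v] shows that
    its right-hand side is nonnegative. *)
Lemma hess_psd x u : Q x -> 0 <= '<(u *m hess f x), u>.
Proof.
move=> Qx; have [->|u0] := eqVneq u 0; first by rewrite pair0r.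
have [_ _ dh] := smooth_diff Qx.
have := qsc u u Qx; have := qsc u (- u) Qx.
rewrite !D3E // linearN mulmxN pairNl pnormN => H1 H2.
have k0 : 0 < M * pnorm B u by rewrite mulr_gt0 ?pnorm_gt0.
by rewrite -(pmulr_rge0 _ k0) mulrAC; lra.
Qed.

(** Along the segment, [w' <= w / 2] for [w (t)] the Hessian form at time [t].
    This makes [w (t) (1 - t / 2)] nonincreasing, an elementary substitute for
    the exponential in Gronwall's inequality. *)
Lemma hess_along_le x z (t : R) : Q x -> Q z -> M * pnorm B (z - x) <= 1 / 2 ->
  0 <= t <= 1 ->
  '<((z - x) *m hess f (x + t *: (z - x))), (z - x)>
    <= 2 * '<((z - x) *m hess f x), (z - x)>.
Proof.
move=> Qx Qz hM /andP[t0 t1]; set h := z - x.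
pose w (r : R) := '<(h *m hess f (x + r *: h)), h>.
pose a (r : R) := w r * (1 - r / 2).
have Qt r : 0 <= r <= t -> Q (x + r *: h).
  by move=> /andP[r0 rt]; apply: sQ => //; rewrite r0 (le_trans rt).
have : a t <= a 0.
  apply: (@le_of_derive_le0 _ a
    (fun r => D3 f (x + r *: h) h h h * (1 - r / 2) - w r / 2)
    0 t t0) => r /[dup] rt /andP[r0 r1].
    by apply/is_derive_damped/is_derive_hess; exact: Qt.
  have := qsc h h (Qt _ rt); have := hess_psd h (Qt _ rt); rewrite -/(w r).
  move: (D3 _ _ _ _ _) => D w0 hD.
  have : D <= w r * (1 / 2).
    by apply: (le_trans hD); rewrite mulrAC mulrC ler_wpM2l.
  by nra.
have -> : a 0 = w 0 by rewrite /a; field.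
rewrite /a => H; suff : w t <= 2 * w 0 by rewrite /w scale0r addr0.
have w0 : 0 <= w t by apply: hess_psd; apply: Qt; rewrite t0 lexx.
exact: undamp t1 w0 H.
Qed.

(** Pair the residual with [u] and differentiate twice along the segment: by
    symmetry the second derivative is the third derivative of [f] in the
    directions [h, h, u], so that quasi-self-concordance bounds it by the
    Hessian form at [h], which at most doubles along the segment. *)
Lemma newton_residual_le x z : Q x -> Q z -> M * pnorm B (z - x) <= 1 / 2 ->
  dnorm B (newton_residual f x z) <= M * '<((z - x) *m hess f x), (z - x)>.
Proof.
move=> Qx Qz hM; set h := z - x; set k := '<_, _>.
have k0 : 0 <= k by apply: hess_psd.
apply: dnorm_le => // [|u]; first by rewrite mulr_ge0 // ltW.
have Qt r : 0 <= r <= 1 -> Q (x + r *: h) by move=> r01; exact: sQ.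
pose c := 2 * M * k * pnorm B u.
pose a1 (r : R) := '<(h *m hess f (x + r *: h)), u> - r * c.
pose b (r : R) := '<(h *m hess f x), u>.
have le1 t : 0 <= t <= 1 ->
    '<(h *m hess f (x + t *: h)), u> - '<(h *m hess f x), u> - t * c <= 0.
  move=> /andP[t0 t1].
  have : a1 t <= a1 0.
    apply: (@le_of_derive_le0 _ a1
      (fun r => D3 f (x + r *: h) h u h - c) 0 t t0) => r /andP[r0 rt].
      by apply/is_derive_sub_linear/is_derive_hess/Qt; rewrite r0 (le_trans rt).
    have r01 : 0 <= r <= 1 by rewrite r0 (le_trans rt).
    rewrite subr_le0 D3_sym; last exact: Qt.
    apply: (le_trans (qsc _ _ (Qt _ r01))).
    have hk : '<(h *m hess f (x + r *: h)), h> <= 2 * k by exact: hess_along_le.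
    exact: (ler_prod3 (ltW M0) (pnorm_ge0 u) hk).
  by rewrite /a1 scale0r addr0; apply: from_linear.
pose a2 (r : R) := '<(grad f (x + r *: h)), u> - r * '<(h *m hess f x), u>
                   - r ^+ 2 * (c / 2).
have : a2 1 <= a2 0.
  apply: (@le_of_derive_le0 _ a2 (fun r => '<(h *m hess f (x + r *: h)), u>
     - '<(h *m hess f x), u> - r * c) 0 1 ler01) => r r01; last exact: le1.
  have -> : r * c = r * (2 * (c / 2)) by field.
  by apply/is_derive_sub_quadratic/is_derive_sub_linear/is_derive_grad/Qt.
rewrite /a2 scale0r addr0 scale1r /h subrKC -/h => /from_quadratic.
by rewrite /newton_residual -/h !pairBl /c half_prod3.
Qed.

End QuasiSelfConcordance.

(** * Newton steps on a regularized composite model *)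

Section Extension.
Context {R : realType} {n : nat}.
Implicit Types (s x y : 'rV[R]_n) (Q : set 'rV[R]_n) (p q : 'rV[R]_n -> R)
  (psi : 'rV[R]_n -> \bar R).

(** The set [Q] and the real function [p] represent the extended-valued function
    equal to [p] on [Q] and to [+oo] elsewhere. *)
Definition extends Q p psi :=
  (forall x, Q x -> psi x = (p x)%:E) /\ (forall x, ~ Q x -> psi x = +oo%E).

Lemma extends_edom Q p psi x : extends Q p psi -> edom psi x <-> Q x.
Proof.
move=> [E1 E2]; rewrite /edom /=; split=> [|Qx]; last by rewrite E1 ?ltry.
by have [//|nQ] := pselect (Q x); rewrite E2.
Qed.

Lemma extends_add Q p psi q : extends Q p psi ->
  extends Q (fun x => q x + p x) (fun x => ((q x)%:E + psi x)%E).
Proof. by move=> [E1 E2]; split=> x Qx; [rewrite E1 | rewrite E2]. Qed.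

Lemma extends_argmin Q p psi x : extends Q p psi ->
  is_argmin psi x <-> min_on Q p x.
Proof.
move=> E; split=> [[/(extends_edom _ E) Qx mx]|[Qx mx]].
  by split=> // y Qy; have := mx y; rewrite !E.1.
split=> [|y]; first exact/(extends_edom _ E).
have [Qy|nQ] := pselect (Q y); first by rewrite !E.1 // lee_fin mx.
by rewrite (E.2 y) // leey.
Qed.

Lemma extends_subdiff Q p psi x s : extends Q p psi ->
  subdiff psi x s <-> subgrad Q p x s.
Proof.
move=> E; split=> [[fx sx]|[Qx sx]].
  have Qx : Q x.
    by apply: contrapT => nQ; move: fx; rewrite (E.2 x).
  split=> // y Qy.
  by have := sx y; rewrite !E.1 // -EFinD lee_fin.
split; first by rewrite E.1.
move=> y; have [Qy|nQ] := pselect (Q y); last by rewrite (E.2 y) // leey.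
by rewrite !E.1 // -EFinD lee_fin sx.
Qed.

End Extension.

(** With [x = m r], this is [x (1 - 2 x) <= 1 / 8]. *)
Lemma newton_decay_arith (R : realType) (m k g r d : R) :
  0 < m -> 0 <= r -> 0 <= d -> d <= g ->
  k + 2 * m * g * r ^+ 2 + r ^+ 2 <= d * r -> m * k <= d / 8.
Proof.
move=> m0 r0 d0 dg key.
have le1 : m * k <= d * (m * r) - 2 * g * (m * r) ^+ 2.
  rewrite -subr_ge0 (_ : _ - _ = m * (d * r - (k + 2 * m * g * r ^+ 2))).
    by rewrite mulr_ge0 ?(ltW m0) // subr_ge0; have := sqr_ge0 r; lra.
  by ring.
have le2 : d * (m * r) ^+ 2 <= g * (m * r) ^+ 2 by rewrite ler_wpM2r ?sqr_ge0.
have : 0 <= d * (4 * (m * r) - 1) ^+ 2 by rewrite mulr_ge0 ?sqr_ge0.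
by lra.
Qed.

Section Quadratic.
Context {R : realType} {n : nat} {B : 'M[R]_n}.
Hypothesis hB : self_adjoint_posdef B.
Implicit Types (s u v x y z h : 'rV[R]_n) (Q : set 'rV[R]_n)
  (p q : 'rV[R]_n -> R).

Lemma differentiable_pairing (V : normedModType R) (G1 G2 : V ->
  'rV[R]_n) (x : V) :
  differentiable G1 x -> differentiable G2 x ->
  differentiable (fun y : V => '<(G1 y), (G2 y)>) x.
Proof.
move=> d1 d2.
have -> : (fun y : V => '<(G1 y), (G2 y)>) =
   \sum_(i < n) ((fun y : V => G1 y 0 i) * (fun y : V => G2 y 0 i)).
  apply/funext => w; rewrite fct_sumE; exact: eq_bigr.
have dc (G : V -> 'rV[R]_n) i : differentiable G x ->
  differentiable (fun y : V => G y 0 i) x.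
  move=> dG; apply: (@differentiable_comp _ _ _ _ G (fun N : 'rV[R]_n => N 0
    i)) => //.
  exact: differentiable_coord.
by apply: differentiable_sum => i; apply: differentiableM; exact: dc.
Qed.

Variables (a : 'rV[R]_n) (H : 'M[R]_n) (z c : 'rV[R]_n) (m : R).

Definition quad y :=
  '<a, (y - z)> + 2^-1 * '<((y - z) *m H), (y - z)> + m * pnorm B (y - c) ^+ 2.

Definition quad_grad y := a + (y - z) *m H + (2 * m) *: ((y - c) *m B).

Hypothesis H_sym : forall u v, '<(u *m H), v> = '<(v *m H), u>.
Hypothesis H_psd : forall u, 0 <= '<(u *m H), u>.
Hypothesis m0 : 0 <= m.

Definition quad_curv h := 2^-1 * '<(h *m H), h> + m * '<(h *m B), h>.

Lemma quad_curv_ge0 h : 0 <= quad_curv h.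
Proof. by rewrite addr_ge0 // mulr_ge0 ?(ip_ge0 hB) ?invr_ge0. Qed.

(** The expansion is exact, so that the subgradient, convexity and splitting
    properties of the quadratic model follow from the sign of [quad_curv]. *)
Lemma quad_expand u h t :
  quad (u + t *: h) = quad u + t * '<(quad_grad u), h> + t ^+ 2 * quad_curv h.
Proof.
rewrite /quad /quad_grad /quad_curv !(sqr_pnorm hB).
have -> : u + t *: h - z = (u - z) + t *: h by rewrite addrAC.
have -> : u + t *: h - c = (u - c) + t *: h by rewrite addrAC.
move: (u - z) (u - c) => d e.
by rewrite !pairLR -!scalemxAl !pairLR (H_sym h d) (ipC hB h e); field.
Qed.

Lemma quad_subgrad Q u : Q u -> subgrad Q quad u (quad_grad u).
Proof.
move=> Qu; split=> // y _; have := quad_expand u (y - u) 1.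
by rewrite scale1r subrKC => ->; have := quad_curv_ge0 (y - u); lra.
Qed.

Lemma quad_convex Q : convex_mod B 0 Q quad.
Proof.
move=> x y t _ _ /andP[t0 t1]; have := quad_expand x (y - x) 1.
rewrite scale1r subrKC quad_expand => ->.
have : t ^+ 2 * quad_curv (y - x) <= t * quad_curv (y - x).
  by rewrite ler_wpM2r ?quad_curv_ge0 // expr2 ler_piMl.
by lra.
Qed.

Lemma quad_continuous : continuous quad.
Proof.
move=> y; apply: differentiable_continuous.
have db d : differentiable (fun x : 'rV[R]_n => x - d) y.
  by apply: differentiableB => //; exact: differentiable_cst.
have dm (A : 'M[R]_n) d : differentiable (fun x : 'rV[R]_n => (x - d) *m A) y.
  exact: (@differentiable_linear_comp _ _ _ _ _ (mulmxr A) (fun x => x - d)).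
have -> : quad = (fun y => '<a, (y - z)>) + 2^-1 \*: (fun y => '<((y - z) *m
  H), (y - z)>)
    + m \*: (fun y => '<((y - c) *m B), (y - c)>).
  by apply/funext => x; rewrite /quad (sqr_pnorm hB).
apply: differentiableD; first apply: differentiableD.
- by apply: differentiable_pairing => //; exact: differentiable_cst.
- by apply: differentiableZ; apply: differentiable_pairing.
- by apply: differentiableZ; apply: differentiable_pairing.
Qed.

Lemma quad_split Q p x s : segment_closed Q -> convex_mod B 0 Q p ->
  subgrad Q (fun y => quad y + p y) x s -> subgrad Q p x (s - quad_grad x).
Proof.
move=> sQ cp; apply: (subgrad_split sQ cp) => y e Qy e0.
have k0 := quad_curv_ge0 (y - x).
have k1 : 0 < quad_curv (y - x) + e by rewrite ltr_wpDl.
set t := e / (quad_curv (y - x) + e); have t0 : 0 < t by rewrite divr_gt0.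
have tk : t * quad_curv (y - x) <= e.
  by rewrite /t mulrAC ler_pdivrMr // ler_pM2l // lerDl ltW.
exists t; first by rewrite t0 /t ler_pdivrMr // mul1r lerDr.
rewrite quad_expand; have := ler_wpM2l (ltW t0) tk; lra.
Qed.

End Quadratic.

Section NewtonStep.
Context {R : realType} {n : nat} {B : 'M[R]_n} {Q : set 'rV[R]_n}.
Context {f : 'rV[R]_n -> R} {p : 'rV[R]_n -> R} {psi : 'rV[R]_n -> \bar R}.
Context {M : R}.
Hypotheses (hB : self_adjoint_posdef B) (sQ : segment_closed Q).
Hypothesis smf : thrice_differentiable_on Q f.
Hypotheses (M0 : 0 < M) (qsc : quasi_self_concordant B Q M f).
Hypotheses (cp : convex_mod B 1 Q p) (clp : closed_sublevels Q p).
Hypothesis psiE : extends Q p psi.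
Implicit Types (s u v w x y z h : 'rV[R]_n).

Let cp0 : convex_mod B 0 Q p.
Proof. exact: (convex_mod_weak ler01 cp). Qed.

Let model_extends z x (g : R) :
  extends Q (fun y => quad (B := B) (grad f z) (hess f z) z x (M * g) y + p y)
    (newton_model B f psi M z x g).
Proof. exact: extends_add. Qed.

Lemma newton_step_exists z x u s (g : R) : 0 <= g -> Q z -> subgrad Q p u s ->
  exists z', is_argmin (newton_model B f psi M z x g) z'.
Proof.
move=> g0 Qz su.
have Mg0 : 0 <= M * g by rewrite mulr_ge0 // ltW.
have hs u' v' := hess_sym smf u' v' Qz.
have hp u' := hess_psd hB smf M0 qsc u' Qz.
have qu := quad_subgrad hB (grad f z) z x hs hp Mg0 su.1.
have [||z' mz'] := strongly_convex_min hB sQ ltr01 _ _ (subgradD qu su).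
- rewrite -[X in convex_mod _ X]add0r.
  by apply: convex_modD => //; exact: (quad_convex hB).
- apply: (closed_sublevelsD clp qu) => y _; exact: quad_continuous.
by exists z'; apply/(extends_argmin _ (model_extends z x g)).
Qed.

Lemma newton_step_subgrad z x z' (g : R) : 0 <= g -> Q z ->
  is_argmin (newton_model B f psi M z x g) z' ->
  subgrad Q p z' (newton_residual f z z' - grad f z'
                  - (2 * M * g) *: ((z' - x) *m B)).
Proof.
move=> g0 Qz /(extends_argmin _ (model_extends z x g)) /min_on_subgrad mz.
have Mg0 : 0 <= M * g by rewrite mulr_ge0 // ltW.
have hs u' v' := hess_sym smf u' v' Qz.
have hp u' := hess_psd hB smf M0 qsc u' Qz.
have := quad_split hB hs hp Mg0 sQ cp0 mz; congr (subgrad _ _ _ _).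
rewrite /quad_grad /newton_residual; apply/rowP => i; rewrite !mxE; ring.
Qed.

(** The vector [s] is a subgradient at [z] of the function that an inner loop
    minimizes, [f + p + M g |. - x|^2]; its norm measures the progress. *)
Definition prox_subgrad x (g : R) z s :=
  subgrad Q p z (s - grad f z - (2 * M * g) *: ((z - x) *m B)).

(** Monotonicity of the subgradients of [p] bounds the step: with
    [r = |z' - z|] and [k] its squared length in the Hessian form,
    [k + 2 M g r^2 <= |s| r]. Hence [M r <= 1 / 2], the Newton residual is at
    most [M k], and the gain is a factor 8. *)
Lemma newton_step_decay x z z' s (g : R) : dnorm B s <= g ->
  prox_subgrad x g z s ->
  is_argmin (newton_model B f psi M z x g) z' ->
  prox_subgrad x g z' (newton_residual f z z') /\
  dnorm B (newton_residual f z z') <= dnorm B s / 8.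
Proof.
move=> sg ps am; have g0 : 0 <= g := le_trans (dnorm_ge0 _) sg.
have Qz := ps.1; have ps' := newton_step_subgrad g0 Qz am; split => //.
have Qz' := ps'.1; set h := z' - z; set k := '<(h *m hess f z), h>.
have k0 : 0 <= k by apply: (hess_psd hB smf M0 qsc).
set r := pnorm B h; have r0 : 0 <= r by exact: pnorm_ge0.
have := subgrad_monotone sQ cp ps ps'; rewrite mul1r -/h.
have -> : newton_residual f z z' - grad f z' - (2 * M * g) *: ((z' - x) *m B) -
    (s - grad f z - (2 * M * g) *: ((z - x) *m B)) =
    - s - h *m hess f z - (2 * M * g) *: (h *m B).
  have -> : z' - x = h + (z - x) by rewrite subrKA.
  rewrite /newton_residual (mulmxDl h (z - x) B) -/h.
  move: (grad f z') (grad f z) (h *m hess f z) (h *m B) ((z - x) *m B) => *.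
  by apply/rowP => i; rewrite !mxE; ring.
rewrite !pairBl pairNl pairZl -/k -(sqr_pnorm hB) -/r => mono.
have := pair_le hB s (- h); rewrite pairNr pnormN -/r => sr.
set S := dnorm B s in sr sg *; have S0 : 0 <= S by exact: dnorm_ge0.
have {mono}key : k + 2 * M * g * r ^+ 2 + r ^+ 2 <= S * r by lra.
have rM : M * r <= 1 / 2.
  have [gp|] := ltP 0 g; last first.
    move=> g_le0; have gE : g = 0 by apply/le_anti; rewrite g_le0.
    have SE : S = 0 by apply/le_anti; rewrite S0 -gE sg.
    (* strong convexity of p alone forces the step to vanish *)
    have rE : r ^+ 2 <= 0 by rewrite SE gE in key; lra.
    have -> : r = 0 by apply/eqP; rewrite -sqrf_eq0; apply/eqP/le_anti;
      rewrite rE sqr_ge0.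
    by rewrite mulr0; lra.
  have [->|rn0] := eqVneq r 0; first by rewrite mulr0; lra.
  have rp : 0 < r by rewrite lt0r rn0.
  have : 2 * M * g * r * r <= g * r by have := ler_wpM2r r0 sg; nra.
  rewrite ler_pM2r // -[leRHS]mulr1 (_ : 2 * M * g * r = g * (2 * (M * r)));
    last by ring.
  by rewrite ler_pM2l //; lra.
have := newton_residual_le hB sQ smf M0 qsc Qz Qz' rM; rewrite -/h -/k => res.
apply: (le_trans res).
exact: newton_decay_arith key.
Qed.

End NewtonStep.

(** * Inner loops as inexact proximal steps *)

Section Sequences.
Context {R : realType}.
Implicit Types (r d e : nat -> R).

(** Telescoping: [1 / (k + 2)^2 <= 1 / (k + 1) - 1 / (k + 2)]. *)
Lemma sum_inv_sqr_le (k : nat) :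
  \sum_(0 <= i < k) (i.+1%:R ^+ 2)^-1 <= 2 :> R.
Proof.
case: k => [|k]; first by rewrite big_nil.
suff : \sum_(0 <= i < k.+1) (i.+1%:R ^+ 2)^-1 <= 2 - k.+1%:R^-1 :> R.
  by move/le_trans; apply; rewrite gerBl invr_ge0.
elim: k => [|k IH]; first by rewrite big_nat1 expr1n invr1; lra.
rewrite big_nat_recr //=; apply: le_trans (lerD IH (lexx _)) _.
have k0 : 0 <= k%:R :> R by [].
rewrite -[k.+2%:R]natr1 -[k.+1%:R]natr1; move: (k%:R) k0 => x x0.
have p1 : 0 < x + 1 by lra.
have p2 : 0 < x + 1 + 1 by lra.
have -> : 2 - (x + 1 + 1)^-1 =
   2 - (x + 1)^-1 + ((x + 1) * (x + 1 + 1))^-1 :> R.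
  by field; rewrite !gt_eqF.
by rewrite lerD2l lef_pV2 ?posrE ?exprn_gt0 ?mulr_gt0 // expr2 ler_wpM2r; lra.
Qed.

Lemma sum_step_le (a : R) k : 0 <= a ->
  \sum_(0 <= j < k) (a / j.+1%:R ^+ 2) <= 2 * a.
Proof. by move=> a0; rewrite -mulr_sumr mulrC ler_wpM2r // sum_inv_sqr_le. Qed.

Lemma sum_step_sqr_le (a : R) k : 0 <= a ->
  \sum_(0 <= j < k) (a / j.+1%:R ^+ 2) ^+ 2 <= 2 * a ^+ 2.
Proof.
move=> a0; apply: (@le_trans _ _ (\sum_(0 <= j < k) a * (a / j.+1%:R ^+ 2))).
  apply: ler_sum => j _; rewrite expr2 ler_wpM2r ?divr_ge0 ?exprn_ge0 //.
  by rewrite ler_pdivrMr ?exprn_gt0 // ler_peMr // exprn_ege1 // ler1n.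
by rewrite -mulr_sumr; have := ler_wpM2l a0 (sum_step_le k a0); lra.
Qed.

Lemma fejer_arith (t r2 p a d e : R) :
  0 <= t -> 0 <= r2 -> 0 <= d -> 0 <= e -> 0 <= a ->
  t + p <= a ^+ 2 -> r2 + d ^+ 2 - p <= 2 * e * d ->
  t + r2 + d ^+ 2 <= (a + 2 * e) ^+ 2.
Proof.
move=> t0 r0 d0 e0 a0 H1 H2.
have da : d <= a + 2 * e.
  rewrite leNgt; apply/negP => ad.
  have : 0 < d * (d - 2 * e - a) by rewrite mulr_gt0; lra.
  have : a * a <= d * a by rewrite ler_wpM2r //; lra.
  by lra.
by have := ler_wpM2l e0 da; nra.
Qed.

(** A perturbed Fejer inequality: up to the errors [e], the squared distances
    decrease by [r j ^+ 2]. It is used twice, for the distances of the Dual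
    Newton iterates to a minimizer and for the potential of the whole
    scheme. *)
Lemma fejer_bound (N : nat) r d e :
  (forall j, 0 <= d j) -> (forall j, 0 <= e j) ->
  (forall j, (j < N)%N ->
    r j ^+ 2 + d j.+1 ^+ 2 - d j ^+ 2 <= 2 * e j * d j.+1) ->
  forall k, (k <= N)%N ->
    \sum_(0 <= j < k) r j ^+ 2 + d k ^+ 2
      <= (d 0%N + 2 * \sum_(0 <= j < k) e j) ^+ 2.
Proof.
move=> d0 e0 step; elim=> [|k IH] kN.
  by rewrite !big_nil mulr0 add0r addr0.
have {IH} := IH (ltnW kN); have := step k kN.
rewrite !big_nat_recr //=.
have T0 : 0 <= \sum_(0 <= j < k) r j ^+ 2 by rewrite sumr_ge0 // => j _;
  exact: sqr_ge0.
have S0 : 0 <= \sum_(0 <= j < k) e j by rewrite sumr_ge0.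
have a0 : 0 <= d 0%N + 2 * \sum_(0 <= j < k) e j
  by rewrite addr_ge0 // mulr_ge0.
move=> H1 H2; rewrite mulrDr addrA.
exact: (fejer_arith T0 (sqr_ge0 (r k)) (d0 k.+1) (e0 k) a0 H2 H1).
Qed.

(** If the factors [4 m^2 (r + e)^2] have a bounded sum then [g] decays
    exponentially, because [a <= expR (a - 1)] turns the product of the factors
    into the exponential of their sum minus their number. *)
Lemma growth_bound (N : nat) (g r e : nat -> R) (m : R) : 0 <= m ->
  (forall j, 0 <= g j) -> (forall j, 0 <= r j) -> (forall j, 0 <= e j) ->
  (forall j, (j < N)%N -> g j.+1 <= 2 * m * g j * (r j + e j)) ->
  g N ^+ 2 <= g 0%N ^+ 2 *
    expR (\sum_(0 <= j < N) 4 * m ^+ 2 * (r j + e j) ^+ 2 - N%:R).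
Proof.
move=> m0 g0 r0 e0; elim: N => [|N IH] step.
  by rewrite big_nil subr0 expR0 mulr1.
have {IH} := IH (fun j jN => step j (ltnW jN)).
rewrite big_nat_recr //= -[N.+1%:R]natr1; set S := \sum_(_ <= _ < _) _ => IH.
set a := 4 * _ * _.
have -> : S + a - (N%:R + 1) = (S - N%:R) + (a - 1) by ring.
rewrite expRD mulrA.
have ga : g N.+1 ^+ 2 <= g N ^+ 2 * a.
  have -> : g N ^+ 2 * a = (2 * m * g N * (r N + e N)) ^+ 2 by rewrite /a; ring.
  rewrite ler_pXn2r ?nnegrE ?g0 ?step //.
  by rewrite !mulr_ge0 ?addr_ge0.
have ae : a <= expR (a - 1) by have := expR_ge1Dx (a - 1); lra.
have a0 : 0 <= a.
  by apply: mulr_ge0; [apply: mulr_ge0 => // | ]; exact: sqr_ge0.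
apply: le_trans ga _; apply: le_trans (ler_wpM2r a0 IH) _.
by rewrite ler_wpM2l // mulr_ge0 ?sqr_ge0 ?expR_ge0.
Qed.

Lemma geometric_small (c k : R) : 0 <= c -> 0 < k ->
  exists t : nat, c / 8 ^+ t.+1 <= c * k.
Proof.
move=> c0 k0; exists (Num.truncn k^-1); rewrite ler_wpM2l //.
rewrite invf_ple ?posrE ?exprn_gt0 //; set t := Num.truncn _.
have : k^-1 < t.+1%:R by rewrite truncnS_gt.
move/ltW/le_trans; apply; rewrite -natrX ler_nat; exact: ltnW (ltn_expl _ _).
Qed.

End Sequences.

Section DualNewton.
Context {R : realType} {n : nat} {B : 'M[R]_n} {Q : set 'rV[R]_n}.
Context {f : 'rV[R]_n -> R} {p : 'rV[R]_n -> R} {psi : 'rV[R]_n -> \bar R}.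
Context {M nu : R}.
Hypotheses (hB : self_adjoint_posdef B) (sQ : segment_closed Q).
Hypotheses (smf : thrice_differentiable_on Q f) (cf : convex_mod B 0 Q f).
Hypotheses (M0 : 0 < M) (qsc : quasi_self_concordant B Q M f).
Hypotheses (cp : convex_mod B 1 Q p) (clp : closed_sublevels Q p).
Hypotheses (psiE : extends Q p psi) (nu0 : 0 < nu).
Implicit Types (s u v w x y z h : 'rV[R]_n).

Let cp0 : convex_mod B 0 Q p.
Proof. exact: (convex_mod_weak ler01 cp). Qed.

Let F x := f x + p x.

Let cF : convex_mod B 1 Q F.
Proof. by have := convex_modD cf cp; rewrite add0r. Qed.

Let F_extends : extends Q F (composite f psi).
Proof. exact: extends_add. Qed.

Let split_F x s : subgrad Q F x s -> subgrad Q p x (s - grad f x).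
Proof.
move=> sx; have [df _ _] := smooth_diff smf sx.1.
exact: (subgrad_split_diff sQ cp0 df).
Qed.

(** The residual is divided by 8 at each step, whereas the threshold is a fixed
    multiple of the initial bound [g]; this includes [g = 0]. *)
Lemma inner_loop_exists (j : nat) x (g : R) s : subgrad Q F x s ->
  dnorm B s <= g ->
  exists (z : nat -> 'rV[R]_n) (T : nat), inner_loop B f psi M nu j x g z T.
Proof.
move=> sx sg; have g0 : 0 <= g := le_trans (dnorm_ge0 _) sg.
have sp := split_F sx.
have /choice[step hstep] : forall z, exists z',
    Q z -> is_argmin (newton_model B f psi M z x g) z'.
  move=> z; have [Qz|nQ] := pselect (Q z); last by exists z.
  have [z' hz'] := newton_step_exists hB sQ smf M0 qsc cp clp psiE x g0 Qz sp.
  by exists z'.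
pose z t := iter t step x.
have inv t : exists2 sg_t, @prox_subgrad _ _ B Q f p M x g (z t) sg_t &
    dnorm B sg_t <= g / 8 ^+ t.
  elim: t => [|t [st pst st_le]].
    exists s; last by rewrite expr0 divr1.
    by rewrite /prox_subgrad subrr mul0mx scaler0 subr0.
  have st_g : dnorm B st <= g.
    apply: le_trans st_le _; rewrite ler_pdivrMr ?exprn_gt0 //.
    by rewrite ler_peMr // exprn_ege1 // ler1n.
  have [ps le8] := newton_step_decay hB sQ smf M0 qsc cp psiE st_g pst
                     (hstep _ pst.1).
  exists (newton_residual f (z t) (z t.+1)) => //.
  apply: le_trans le8 _; rewrite exprSr invfM mulrA ler_wpM2r //.
have am t : is_argmin (newton_model B f psi M (z t) x g) (z t.+1).
  by have [st [Qz _] _] := inv t; exact: hstep.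
have [T hT] : exists T, inner_stop B f M nu j g (z T) (z T.+1).
  have k0 : 0 < 2 * M * nu / j.+1%:R ^+ 2
    by rewrite divr_gt0 ?mulr_gt0 ?exprn_gt0.
  have [T hT] := geometric_small g0 k0; exists T; rewrite /inner_stop.
  have [st pst st_le] := inv T.
  have st_g : dnorm B st <= g.
    apply: le_trans st_le _; rewrite ler_pdivrMr ?exprn_gt0 //.
    by rewrite ler_peMr // exprn_ege1 // ler1n.
  have [_ le8] := newton_step_decay hB sQ smf M0 qsc cp psiE st_g pst (am T).
  apply: le_trans le8 _; apply: (@le_trans _ _ (g / 8 ^+ T.+1)).
    by rewrite exprSr invfM mulrA ler_wpM2r.
  by apply: le_trans hT _; rewrite !mulrA (mulrC g) -!mulrA (mulrCA g).
pose P := [pred T | `[<inner_stop B f M nu j g (z T) (z T.+1)>]].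
have exP : exists T, P T by exists T; apply/asboolP.
case: (ex_minnP exP) => T' /asboolP PT' minT'.
exists z, T'; split=> // t tT' /asboolP Pt.
by have := minT' t Pt; rewrite leqNgt tT'.
Qed.

(** An outer iteration of the Dual Newton Method is only used through this
    property: [x'] is a proximal point of [x] for [F], with coefficient
    [2 M g], up to the error allowed by the stopping test. *)
Definition prox_step (j : nat) x (g : R) x' s' :=
  subgrad Q F x' s' /\
  dnorm B (s' + (2 * M * g) *: ((x' - x) *m B)) <= 2 * M * g * nu / j.+1%:R ^+
    2.

Lemma dual_newton_iteration_prox (j : nat) x (g : R) x' (g' : R) : 0 <= g ->
  Q x ->
  dual_newton_iteration B f psi M nu j x g x' g' ->
  exists2 s', prox_step j x g x' s' & g' = dnorm B s'.
Proof.
move=> g0 Qx [z [T [[z0 am nstop stop] -> ->]]].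
have Qz t : (t <= T)%N -> Q (z t).
  elim: t => [_|t IH tT]; first by rewrite z0.
  exact: (newton_step_subgrad hB sQ smf M0 qsc cp psiE g0 (IH (ltnW tT))
     (am t (ltnW tT))).1.
have ps := newton_step_subgrad hB sQ smf M0 qsc cp psiE g0 (Qz T (leqnn T))
  (am T (leqnn T)).
eexists; last reflexivity; split; last by rewrite subrK.
have [df _ _] := smooth_diff smf ps.1.
have := subgradD (subgrad_grad sQ (lexx 0) cf ps.1 df) ps.
by rewrite addrCA addrA subrK -addrA addrC.
Qed.

Lemma dual_newton_iteration_exists (j : nat) x s : subgrad Q F x s ->
  exists x' g', dual_newton_iteration B f psi M nu j x (dnorm B s) x' g'.
Proof.
move=> sx; have [z [T il]] := inner_loop_exists j sx (lexx _).
by do 2!eexists; exists z, T; split=> //; exact: il.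
Qed.

Lemma prox_step_growth j x (g : R) x' s' : 0 <= g -> prox_step j x g x' s' ->
  dnorm B s' <= 2 * M * g * (pnorm B (x' - x) + nu / j.+1%:R ^+ 2).
Proof.
move=> g0 [_ le_s].
have c0 : 0 <= 2 * M * g by rewrite !mulr_ge0 // ltW.
rewrite -[X in dnorm B X](addrK ((2 * M * g) *: ((x' - x) *m B))).
apply: le_trans (dnormB hB _ _) _.
rewrite dnormZ // dnorm_mulB // ger0_norm // mulrDr [leRHS]addrC mulrA.
by rewrite lerD2r.
Qed.

(** The subgradient at [x'] makes an acute angle with [x' - xs], and it is
    almost proportional to [x - x']. *)
Lemma prox_step_fejer j x s x' s' xs : min_on Q F xs -> subgrad Q F x s ->
  prox_step j x (dnorm B s) x' s' ->
  pnorm B (x' - x) ^+ 2 + pnorm B (x' - xs) ^+ 2 - pnorm B (x - xs) ^+ 2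
    <= 2 * (nu / j.+1%:R ^+ 2) * pnorm B (x' - xs).
Proof.
move=> /min_on_subgrad ms sx [sx' le_s].
set g := dnorm B s in le_s; have g0 : 0 <= g by exact: dnorm_ge0.
rewrite -(mulrA (2 * M * g)) in le_s.
set e := nu / _ in le_s *; have e0 : 0 <= e
  by rewrite divr_ge0 ?exprn_ge0 // ltW.
have := subgrad_monotone sQ cF ms sx'; rewrite subr0 mul1r => m'.
have := subgrad_monotone sQ cF ms sx; rewrite subr0 mul1r => m.
have tri : pnorm B (x' - x) ^+ 2 + pnorm B (x' - xs) ^+ 2 - pnorm B (x - xs) ^+
  2
    = 2 * '<((x' - x) *m B), (x' - xs)>.
  have -> : x - xs = (x' - xs) - (x' - x) by rewrite opprB [RHS]addrC subrKA.
  move: (x' - x) (x' - xs) => a b.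
  by rewrite !(sqr_pnorm hB) !pairLR (ipC hB b a); ring.
set d' := pnorm B (x' - xs) in m' *; have d0 : 0 <= d' by exact: pnorm_ge0.
have [gp|g_le0] := ltP 0 g.
  have := pair_le hB (s' + (2 * M * g) *: ((x' - x) *m B)) (x' - xs).
  rewrite pairDl pairZl -/d' => H.
  have {}H := le_trans H (ler_wpM2r d0 le_s).
  have k0 : 0 < 2 * M * g by rewrite !mulr_gt0.
  have : 2 * M * g * '<((x' - x) *m B), (x' - xs)> <= 2 * M * g * (e * d').
    by have := sqr_ge0 d'; lra.
  by rewrite ler_pM2l // tri; lra.
have gE : g = 0 by apply/le_anti; rewrite g_le0.
(* for g = 0 both x and x' minimize F *)
have s0 : s = 0 by exact: (dnorm_eq0 hB gE).
rewrite gE mulr0 scale0r addr0 !mul0r in le_s.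
have s'0 : s' = 0.
  by apply: (dnorm_eq0 hB); apply/le_anti; rewrite le_s dnorm_ge0.
rewrite s0 pair0l in m; rewrite s'0 pair0l in m'.
have zero a : pnorm B a ^+ 2 <= 0 -> a = 0.
  move=> a0; apply: (pnorm_eq0 hB); apply/eqP; rewrite -sqrf_eq0.
  by apply/eqP/le_anti; rewrite a0 sqr_ge0.
have /zero /eqP := m'; rewrite subr_eq0 => /eqP x'E.
have /zero /eqP := m; rewrite subr_eq0 => /eqP xE.
by rewrite /d' x'E xE subrr pnorm0 expr0n /= !subr0 mulr0 addr0.
Qed.

End DualNewton.

(** * Complexity of the Dual Newton Method *)

Section DualNewtonRun.
Context {R : realType} {n : nat} {B : 'M[R]_n} {Q : set 'rV[R]_n}.
Context {f : 'rV[R]_n -> R} {p : 'rV[R]_n -> R} {psi : 'rV[R]_n -> \bar R}.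
Context {M nu : R}.
Hypotheses (hB : self_adjoint_posdef B) (sQ : segment_closed Q).
Hypotheses (smf : thrice_differentiable_on Q f) (cf : convex_mod B 0 Q f).
Hypotheses (M0 : 0 < M) (qsc : quasi_self_concordant B Q M f).
Hypotheses (cp : convex_mod B 1 Q p) (clp : closed_sublevels Q p).
Hypotheses (psiE : extends Q p psi) (nu0 : 0 < nu).
Implicit Types (s u v w y z h : 'rV[R]_n).

Let F x := f x + p x.

Let cF : convex_mod B 1 Q F.
Proof. by have := convex_modD cf cp; rewrite add0r. Qed.

Let F_extends : extends Q F (composite f psi).
Proof. exact: extends_add. Qed.

Lemma objective_min_exists a s : subgrad Q F a s -> exists xs, min_on Q F xs.
Proof.
move=> sa; apply: (strongly_convex_min hB sQ ltr01 cF _ sa).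
have [df _ _] := smooth_diff smf sa.1.
apply: (closed_sublevelsD clp (subgrad_grad sQ (lexx 0) cf sa.1 df)) => y Qy.
by apply: differentiable_continuous; have [] := smooth_diff smf Qy.
Qed.

Let eps_ge0 (j : nat) : 0 <= nu / j.+1%:R ^+ 2.
Proof. by rewrite divr_ge0 ?exprn_ge0 // ltW. Qed.

Section Iterates.
Variables (N : nat) (x : nat -> 'rV[R]_n) (g : nat -> R) (s0 : 'rV[R]_n).
Hypotheses (sx0 : subgrad Q F (x 0%N) s0) (g0E : g 0%N = dnorm B s0).
Hypothesis iter : forall j, (j < N)%N ->
  dual_newton_iteration B f psi M nu j (x j) (g j) (x j.+1) (g j.+1).

Lemma iterates_subgrad j : (j <= N)%N ->
  exists2 s, subgrad Q F (x j) s & g j = dnorm B s.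
Proof.
elim: j => [_|j IH jN]; first by exists s0.
have [s sx gE] := IH (ltnW jN).
have g0 : 0 <= g j by rewrite gE dnorm_ge0.
have [s' [sx' _] gE'] :=
  dual_newton_iteration_prox hB sQ smf cf M0 qsc cp psiE g0 sx.1 (iter jN).
by exists s'.
Qed.

(** The Fejer inequality bounds the sum of the squared displacements by
    [(|x 0 - xs| + 4 nu)^2], and the subgradient norms are multiplied at each
    iteration by at most [2 M] times the displacement plus its error. *)
Lemma iterates_decay xs k : min_on Q F xs -> (k <= N)%N ->
  g k ^+ 2 <= g 0%N ^+ 2 *
    expR (16 * M ^+ 2 * (pnorm B (x 0%N - xs) + 4 * nu) ^+ 2 - k%:R).
Proof.
move=> ms kN.
pose r j := pnorm B (x j.+1 - x j); pose d j := pnorm B (x j - xs).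
pose e j : R := nu / j.+1%:R ^+ 2.
have step j : (j < k)%N -> g j.+1 <= 2 * M * g j * (r j + e j) /\
    r j ^+ 2 + d j.+1 ^+ 2 - d j ^+ 2 <= 2 * e j * d j.+1.
  move=> jk; have jN := leq_trans jk kN.
  have [s sx gE] := iterates_subgrad (ltnW jN).
  have g0 : 0 <= g j by rewrite gE dnorm_ge0.
  have [s' ps gE'] :=
    dual_newton_iteration_prox hB sQ smf cf M0 qsc cp psiE g0 sx.1 (iter jN).
  split; first by rewrite gE'; exact: (prox_step_growth hB M0 g0 ps).
  rewrite gE in ps.
  exact: (prox_step_fejer hB sQ cf M0 cp nu0 ms sx ps).
pose h j := g (minn j k).
have gh j : (j <= k)%N -> h j = g j by move=> jk; rewrite /h (minn_idPl jk).
have h0 j : 0 <= h j.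
  have [s _ gE] := iterates_subgrad (leq_trans (geq_minr j k) kN).
  rewrite /h gE; exact: dnorm_ge0.
have r0 j : 0 <= r j by exact: pnorm_ge0.
have growth : forall j, (j < k)%N -> h j.+1 <= 2 * M * h j * (r j + e j).
  by move=> j jk; rewrite !gh ?(ltnW jk) //; exact: (step j jk).1.
have := growth_bound (ltW M0) h0 r0 eps_ge0 growth.
rewrite !gh // => /le_trans; apply; rewrite ler_wpM2l ?sqr_ge0 // ler_expR.
rewrite lerD2r -mulr_sumr.
have d0 j : 0 <= d j by exact: pnorm_ge0.
have fj := fejer_bound d0 eps_ge0 (fun j jk => (step j jk).2) (leqnn k).
set D := pnorm B (x 0%N - xs) + 4 * nu.
have dD : (d 0%N + 2 * \sum_(0 <= j < k) e j) ^+ 2 <= D ^+ 2.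
  have e0 : 0 <= \sum_(0 <= j < k) e j by apply: sumr_ge0 => j _;
    exact: eps_ge0.
  have a0 : 0 <= d 0%N + 2 * \sum_(0 <= j < k) e j.
    by rewrite addr_ge0 // mulr_ge0.
  have b0 : 0 <= D by rewrite addr_ge0 ?pnorm_ge0 // mulr_ge0 // ltW.
  by rewrite ler_pXn2r ?nnegrE // lerD2l; have := sum_step_le k (ltW nu0);
    rewrite /e; lra.
have sr : \sum_(0 <= j < k) r j ^+ 2 <= D ^+ 2.
  by have := sqr_ge0 (d k); have := le_trans fj dD; lra.
have se : \sum_(0 <= j < k) e j ^+ 2 <= D ^+ 2.
  apply: le_trans (sum_step_sqr_le k (ltW nu0)) _; rewrite /D.
  have := mulr_ge0 (d0 0%N) (ltW nu0); have := sqr_ge0 (d 0%N).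
  by have := sqr_ge0 nu; rewrite /d; lra.
have sre : \sum_(0 <= j < k) (r j + e j) ^+ 2 <= 4 * D ^+ 2.
  apply: (@le_trans _ _ (\sum_(0 <= j < k) (2 * r j ^+ 2 + 2 * e j ^+ 2))).
    by apply: ler_sum => j _; have := sqr_ge0 (r j - e j); lra.
  by rewrite big_split /= -!mulr_sumr; lra.
have m0 : 0 <= 4 * M ^+ 2 by rewrite mulr_ge0 ?sqr_ge0.
by have := ler_wpM2l m0 sre; lra.
Qed.

End Iterates.

Lemma count_of_decay (g0 a u t : R) : 0 <= g0 -> 1 <= u -> g0 <= nu * u ->
  nu ^+ 2 < g0 ^+ 2 * expR (a - t) -> t <= a + 2 * ln u.
Proof.
move=> g00 u1 gu H.
have u0 : 0 < u by lra.
have nu20 : 0 < nu ^+ 2 by rewrite exprn_gt0.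
have le1 : g0 ^+ 2 <= nu ^+ 2 * u ^+ 2.
  by rewrite -exprMn ler_pXn2r ?nnegrE // mulr_ge0 ?ltW.
have := lt_le_trans H (ler_wpM2r (expR_ge0 _) le1).
rewrite -mulrA -[X in X < _]mulr1 ltr_pM2l // -[u in u ^+ 2](@lnK R) ?posrE //.
rewrite -expRM_natl -expRD -expR0 ltr_expR; lra.
Qed.

(** The distance from the starting point to the minimizer is replaced by the
    displacement [|out - x0|], since the returned point is within [nu] of the
    minimizer by strong convexity. Displacements are what the potential of the
    outer scheme controls. *)
Lemma dual_newton_run_spec x0 s0 (I : nat) out :
  dual_newton_run B f psi x0 M nu s0 I out ->
  (exists2 s, subgrad Q F out s & dnorm B s <= nu) /\
  forall u : R, 1 <= u -> dnorm B s0 <= nu * u ->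
    I%:R <= 2 + 16 * M ^+ 2 * (pnorm B (out - x0) + 5 * nu) ^+ 2 + 2 * ln u.
Proof.
move=> [x [g [xE [/(extends_subdiff _ _ F_extends) sx0 g0E] it big [I0 gI
  outE]]]].
rewrite -xE in sx0.
have [s sI gIE] := iterates_subgrad sx0 g0E it (leqnn I).
split; first by exists s; rewrite ?outE // -gIE.
move=> u u1 su.
have [xs ms] := objective_min_exists sI.
have near_xs : pnorm B (x 0%N - xs) + 4 * nu <= pnorm B (out - x0) + 5 * nu.
  have := subgrad_monotone sQ cF (min_on_subgrad ms) sI.
  rewrite subr0 mul1r => mono.
  have := le_trans mono (pair_le hB _ _); rewrite -gIE -outE => H.
  have le_nu : pnorm B (out - xs) <= nu.
    have := @pnorm_ge0 _ _ B (out - xs); rewrite le_eqVlt => /predU1P[<-|P0].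
      exact: ltW.
    by rewrite expr2 ler_pM2r // in H; exact: le_trans gI.
  have -> : x 0%N - xs = (x0 - out) + (out - xs) by rewrite xE subrKA.
  by have := pnormD hB (x0 - out) (out - xs); rewrite (pnorm_distC x0); lra.
have c0 : 0 <= 16 * M ^+ 2 by apply: mulr_ge0 => //; exact: sqr_ge0.
have le2 : 16 * M ^+ 2 * (pnorm B (x 0%N - xs) + 4 * nu) ^+ 2 <=
    16 * M ^+ 2 * (pnorm B (out - x0) + 5 * nu) ^+ 2.
  have a0 : 0 <= pnorm B (x 0%N - xs) + 4 * nu.
    by rewrite addr_ge0 ?pnorm_ge0 // mulr_ge0 // ltW.
  have b0 : 0 <= pnorm B (out - x0) + 5 * nu by exact: le_trans near_xs.
  by apply: ler_wpM2l => //; rewrite ler_pXn2r ?nnegrE.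
(* the last but one iterate, when it is not the first, still has g > nu *)
case: I I0 it big gI outE {sI gIE} => // I _ it big gI outE.
have ln0 : 0 <= ln u by rewrite ln_ge0.
have r0 : 0 <= 16 * M ^+ 2 * (pnorm B (x 0%N - xs) + 4 * nu) ^+ 2.
  by apply: mulr_ge0 => //; exact: sqr_ge0.
rewrite -natr1; case: I it big gI outE => [|I] it big gI outE; first by lra.
have := iterates_decay sx0 g0E it ms (leqnSn I.+1) => dec.
have nug : nu < g I.+1 by apply: big; rewrite /= ltnSn.
have nu2 : nu ^+ 2 < g I.+1 ^+ 2.
  by rewrite ltr_pXn2r ?nnegrE ?(ltW nu0) // ltW // (lt_trans nu0).
rewrite g0E in dec.
have := count_of_decay (dnorm_ge0 _) u1 su (lt_le_trans nu2 dec).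
by lra.
Qed.

Lemma dual_newton_terminates x0 s0 : subgrad Q F x0 s0 ->
  exists I out, dual_newton_run B f psi x0 M nu s0 I out.
Proof.
move=> sx0; have [xs ms] := objective_min_exists sx0.
pose ok (st : 'rV[R]_n * R) := exists2 s, subgrad Q F st.1 s & st.2 = dnorm B s.
have /choice[next hnext] : forall jst : nat * ('rV[R]_n * R), exists st',
    ok jst.2 -> dual_newton_iteration B f psi M nu jst.1 jst.2.1 jst.2.2 st'.1
      st'.2.
  move=> [j [x g]]; have [[/= s sx ->]|nok] := pselect (ok (x, g)); last
    by exists (x, g).
  have [x' [g' it]] :=
    dual_newton_iteration_exists hB sQ smf M0 qsc cp clp psiE nu0 j sx.
  by exists (x', g').
pose st := fix st j :=
  if j is j'.+1 then next (j', st j') else (x0, dnorm B s0).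
have ok_st j : ok (st j).
  elim: j => [|j IH]; first by exists s0.
  have [s sx gE] := IH.
  have g0 : 0 <= (st j).2 by rewrite gE dnorm_ge0.
  have [s' [sx' _] gE'] :=
    dual_newton_iteration_prox hB sQ smf cf M0 qsc cp psiE
    g0 sx.1 (hnext (j, st j) IH).
  by exists s'.
pose x j := (st j).1; pose g j := (st j).2.
have it N j : (j < N)%N ->
  dual_newton_iteration B f psi M nu j (x j) (g j) (x j.+1) (g j.+1).
  by move=> _; exact: hnext (j, st j) (ok_st j).
have [N gN] : exists N, g N.+1 <= nu.
  apply: contrapT => /forallNP big.
  set a := 16 * M ^+ 2 * (pnorm B (x0 - xs) + 4 * nu) ^+ 2.
  pose u := 1 + dnorm B s0 / nu.
  have u1 : 1 <= u by rewrite lerDl divr_ge0 ?dnorm_ge0 // ltW.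
  have su : dnorm B s0 <= nu * u.
    by rewrite /u mulrDr mulr1 mulrCA divff ?gt_eqF // mulr1 lerDr ltW.
  pose N := Num.truncn (a + 2 * ln u).
  have := iterates_decay (x := x) (g := g) sx0 erefl (it N.+1) ms (leqnn _).
  have /negP := big N; rewrite -ltNge => nug.
  have nu2 : nu ^+ 2 < g N.+1 ^+ 2.
    by rewrite ltr_pXn2r ?nnegrE ?(ltW nu0) // ltW // (lt_trans nu0).
  move=> dec; have := count_of_decay (dnorm_ge0 _) u1 su (lt_le_trans nu2 dec).
  by apply/negP; rewrite -ltNge truncnS_gt.
have exP : exists N, g N.+1 <= nu by exists N.
case: (ex_minnP exP) => J gJ minJ.
exists J.+1, (x J.+1), x, g; split=> //.
- by split=> //; apply/(extends_subdiff _ _ F_extends).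
- by move=> j; exact: it.
case=> [//|j] /= jJ; rewrite ltNge; apply/negP => gj.
by have := minJ j gj; rewrite leqNgt => /negP; apply.
Qed.

End DualNewtonRun.

(** * Pulling derivatives back along a homothety *)

Section LocalDifferentials.
Context {R : realType}.

(** Differentiability is local. This is needed because the gradient of a
    pullback is only known on an open neighbourhood of the domain. *)
Lemma near_eq_diff (V W : normedModType R) (g1 g2 : V -> W) (x : V) :
  (\near x, g1 x = g2 x) -> differentiable g2 x ->
  differentiable g1 x /\ 'd g1 x = 'd g2 x :> (V -> W).
Proof.
move=> E12 d2.
have c2 := diff_continuous d2.
have E : g1 \o shift x = cst (g1 x) + 'd g2 x +o_ 0 id.
  apply/eqaddoP => e e0; have /eqaddoP /(_ e e0) := diff_locally d2.
  rewrite (nbhs_singleton E12).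
  have : \forall h \near (0 : V), g1 (h + x) = g2 (h + x).
    have := (nbhs0P _ _).1 E12; apply: filterS => h; by rewrite addrC.
  apply: filterS2 => h eh.
  by rewrite -![(_ - _ : _ -> _) _]/(_ - _) /= eh.
have dE := diff_unique c2 E.
by split=> //; apply/diff_locallyP; rewrite dE.
Qed.

Variables (n : nat) (V W : normedModType R) (b : R) (c : V).

Definition homothety (x : V) := b *: x + c.

Lemma differentiable_homothety x : differentiable homothety x.
Proof.
apply: differentiableD; last exact: differentiable_cst.
exact: (@differentiableZ _ _ _ id).
Qed.

Lemma diff_homothety x v : 'd homothety x v = b *: v.
Proof.
have -> : homothety = b \*: id + cst c by [].
rewrite diffD; [|exact: (@differentiableZ _ _ _ id)|exact: differentiable_cst].
rewrite diffZ //= diff_cst diff_val; exact: addr0.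
Qed.

Lemma differentiable_pullback (a : R) (G : V -> W) x :
  differentiable G (homothety x) ->
  differentiable (fun y => a *: G (homothety y)) x.
Proof.
move=> dG; apply: (@differentiableZ _ _ _ (G \o homothety)).
by apply: differentiable_comp => //; exact: differentiable_homothety.
Qed.

Lemma diff_pullback (a : R) (G : V -> W) x v :
  differentiable G (homothety x) ->
  'd (fun y => a *: G (homothety y)) x v = (a * b) *: 'd G (homothety x) v.
Proof.
move=> dG.
have dh := differentiable_homothety x.
have dc : differentiable (G \o homothety) x by exact: differentiable_comp.
have -> : (fun y => a *: G (homothety y)) = a \*: (G \o homothety) by [].
by rewrite diffZ //= diff_comp //= diff_homothety linearZ scalerA.
Qed.

End LocalDifferentials.

#[local] Opaque diff derive.

Section Pullback.
Context {R : realType} {n : nat}.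
Variables (f : 'rV[R]_n -> R) (U Q : set 'rV[R]_n) (a b : R) (c : 'rV[R]_n).
Hypotheses (oU : open U) (dU : forall x, U x ->
  [/\ differentiable f x, differentiable (grad f) x & differentiable (hess f)
    x]).
Implicit Types (u v w x y : 'rV[R]_n).

Let hom := @homothety R _ b c : 'rV[R]_n -> 'rV[R]_n.

Definition pullback (x : 'rV[R]_n) : R := a * f (b *: x + c).

Let near_hom x (P : 'rV[R]_n -> Prop) : U (hom x) ->
  (forall y, U (hom y) -> P y) -> \near x, P x.
Proof.
move=> Ux UP; have : nbhs x (hom @^-1` U).
  have ch : {for x, continuous hom}.
    exact/differentiable_continuous/differentiable_homothety.
  by apply: ch; exact: open_nbhs_nbhs.
exact: filterS UP.
Qed.

Lemma diff_pullback_f x : U (hom x) -> differentiable pullback x.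
Proof.
by move=> /dU[df _ _]; exact: (differentiable_pullback a df).
Qed.

Lemma grad_pullback x : U (hom x) ->
  grad pullback x = (a * b) *: grad f (hom x).
Proof.
move=> Ux; have [df _ _] := dU Ux.
apply: pair_ext => u; rewrite pairZl -!grad_derive //; last
  exact: diff_pullback_f.
rewrite !deriveE //; last exact: diff_pullback_f.
exact: (diff_pullback a u df).
Qed.

Let near_grad x : U (hom x) ->
  \near x, grad pullback x = (a * b) *: grad f (hom x).
Proof. by move=> Ux; apply: (near_hom Ux) => y; exact: grad_pullback. Qed.

Lemma diff_grad_pullback x : U (hom x) -> differentiable (grad pullback) x /\
  forall u, 'd (grad pullback) x u = (a * b * b) *: 'd (grad f) (hom x) u.
Proof.
move=> Ux; have [_ dg _] := dU Ux.
have [d E] := near_eq_diff (near_grad Ux) (differentiable_pullback (a * b) dg).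
split=> [|u]; first exact: d.
have Eu := congr1 (fun h => h u) E.
by apply: (etrans Eu); exact: (diff_pullback (a * b) u dg).
Qed.

Lemma hess_pullback x : U (hom x) ->
  hess pullback x = (a * b * b) *: hess f (hom x).
Proof.
move=> Ux; have [_ E] := diff_grad_pullback Ux.
apply/row_matrixP => i; rewrite !rowE -scalemxAr.
apply: (etrans (esym (diff_grad pullback x _))); apply: (etrans (E _)).
by apply: (congr1 ( *:%R _)); exact: diff_grad.
Qed.

Lemma diff_hess_pullback x : U (hom x) -> differentiable (hess pullback) x /\
  forall u, 'd (hess pullback) x u = (a * b * b * b) *: 'd (hess f) (hom x) u.
Proof.
move=> Ux; have [_ _ dh] := dU Ux.
have nh : \near x, hess pullback x = (a * b * b) *: hess f (hom x).
  by apply: (near_hom Ux) => y; exact: hess_pullback.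
have [d E] := near_eq_diff nh (differentiable_pullback (a * b * b) dh).
split=> [|u]; first exact: d.
have Eu := congr1 (fun h => h u) E.
by apply: (etrans Eu); exact: (diff_pullback (a * b * b) u dh).
Qed.

Lemma D3_pullback x u v w : U (hom x) ->
  D3 pullback x u v w = a * b ^+ 3 * D3 f (hom x) u v w.
Proof.
move=> Ux; have [d E] := diff_hess_pullback Ux; have [_ _ dh] := dU Ux.
apply: (etrans (D3E u v w d)).
apply: (etrans (congr1 (bilin_at u v) (E w))).
rewrite linearZ /=; apply: (etrans (congr1 ( *%R _) (esym (D3E u v w dh)))).
by move: (D3 _ _ _ _ _) => D; ring.
Qed.

Hypotheses (QU : Q `<=` U) (Qhom : forall x, Q x -> Q (hom x)).

Lemma smooth_pullback : thrice_differentiable_on Q pullback.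
Proof.
exists (hom @^-1` U); split.
- apply: open_comp => // x _.
  exact/differentiable_continuous/differentiable_homothety.
- by move=> x Qx; apply: QU; exact: Qhom.
- move=> x Ux; split; first exact: diff_pullback_f.
    by have [] := diff_grad_pullback Ux.
  by have [] := diff_hess_pullback Ux.
Qed.

Variables (B : 'M[R]_n) (M : R).
Hypotheses (a0 : 0 <= a) (b0 : 0 <= b).

(** The homothety of ratio [b] multiplies third derivatives by [b^3] and second
    derivatives by [b^2]; the parameter is therefore multiplied by [b]. *)
Lemma qsc_pullback : quasi_self_concordant B Q M f ->
  quasi_self_concordant B Q (b * M) pullback.
Proof.
move=> qsc x u v Qx; have Qy := Qhom Qx; have Uy := QU Qy.
have ab0 : 0 <= a * b ^+ 3 by rewrite mulr_ge0 ?exprn_ge0.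
rewrite D3_pullback // hess_pullback // -scalemxAr pairZl.
by have := ler_wpM2l ab0 (qsc _ u v Qy); lra.
Qed.

Lemma convex_pullback : convex_mod B 0 Q f -> convex_mod B 0 Q pullback.
Proof.
move=> cf x y t Qx Qy t01; have := cf _ _ t (Qhom Qx) (Qhom Qy) t01.
have -> : hom x + t *: (hom y - hom x) = b *: (x + t *: (y - x)) + c.
  apply/rowP => i; rewrite !mxE; ring.
move=> /(ler_wpM2l a0); rewrite /pullback -/(homothety _ _ _).
rewrite -[b *: x + c]/(hom x) -[b *: y + c]/(hom y); lra.
Qed.

End Pullback.

(** * The subproblems and the potential of the scheme *)

Section ProxTerm.
Context {R : realType} {n : nat} {B : 'M[R]_n} {Q : set 'rV[R]_n}.
Context {p : 'rV[R]_n -> R} {psi : 'rV[R]_n -> \bar R}.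
Hypotheses (hB : self_adjoint_posdef B) (sQ : segment_closed Q).
Hypotheses (cp : convex_mod B 0 Q p) (clp : closed_sublevels Q p).
Hypotheses (psiE : extends Q p psi).
Variables (a : R) (c : 'rV[R]_n).
Hypothesis a0 : 0 < a.
Implicit Types (s u v w x y z h : 'rV[R]_n).

Definition prox_term y := a * p y + 2^-1 * pnorm B (y - c) ^+ 2.

Let q := quad (B := B) 0 0 c c 2^-1.

Let prox_quadE : prox_term = (fun y => q y + a * p y).
Proof.
apply/funext => y; rewrite /prox_term /q /quad pair0l mulmx0 pair0l mulr0.
by rewrite !add0r addrC.
Qed.

Let q_sym u v : '<(u *m (0 : 'M[R]_n)), v> = '<(v *m (0 : 'M[R]_n)), u>.
Proof. by rewrite !mulmx0 !pair0l. Qed.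

Let q_psd u : 0 <= '<(u *m (0 : 'M[R]_n)), u>.
Proof. by rewrite mulmx0 pair0l. Qed.

Let h0 : 0 <= 2^-1 :> R. Proof. by rewrite invr_ge0. Qed.

Let q_gradE x : quad_grad (B := B) 0 0 c c 2^-1 x = (x - c) *m B.
Proof. by rewrite /quad_grad mulmx0 !add0r mulfV // scale1r. Qed.

Let q_subgrad x : Q x -> subgrad Q q x ((x - c) *m B).
Proof.
by move=> Qx; rewrite -q_gradE;
  exact: (quad_subgrad hB _ _ _ q_sym q_psd h0 Qx).
Qed.

Lemma prox_term_convex : convex_mod B 1 Q prox_term.
Proof.
rewrite -[X in convex_mod _ X]add0r; apply: convex_modD.
  by have := convex_modZ (ltW a0) cp; rewrite mulr0.
exact: convex_mod_prox.
Qed.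

Lemma scaled_subgrad x s : subgrad Q p x s ->
  subgrad Q (fun y => a * p y) x (a *: s).
Proof.
move=> [Qx sx]; split=> // y Qy.
by rewrite pairZl -mulrDr ler_wpM2l ?(ltW a0) // sx.
Qed.

Lemma prox_term_subgrad x s : subgrad Q p x s ->
  subgrad Q prox_term x (a *: s + (x - c) *m B).
Proof.
move=> sx; rewrite prox_quadE addrC; apply: subgradD; first
  exact/q_subgrad/sx.1.
exact: scaled_subgrad.
Qed.

(** Subgradients of [p] are recovered from those of the prox term, which is how
    the scheme carries a subgradient of [p] from one subproblem to the next. *)
Lemma prox_term_subgrad_split x s : subgrad Q prox_term x s ->
  exists2 s', subgrad Q p x s' & s = a *: s' + (x - c) *m B.
Proof.
rewrite prox_quadE => sx.
have ap0 : convex_mod B 0 Q (fun y => a * p y).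
  by have := convex_modZ (ltW a0) cp; rewrite mulr0.
have := quad_split hB q_sym q_psd h0 sQ ap0 sx; rewrite q_gradE => [[Qx sx']].
exists (a^-1 *: (s - (x - c) *m B)); last first.
  by rewrite scalerA mulfV ?gt_eqF // scale1r subrK.
split=> // y Qy; rewrite pairZl -(ler_pM2l a0) mulrDr mulrA mulfV ?gt_eqF //.
by rewrite mul1r; exact: sx'.
Qed.

Lemma prox_term_closed x : Q x -> closed_sublevels Q prox_term.
Proof.
move=> Qx; rewrite prox_quadE; apply: closed_sublevelsD (q_subgrad Qx) _.
  move=> m; have := @clp (m / a); congr (closed _).
  by apply/funext => y /=; rewrite ler_pdivlMr // mulrC.
by move=> y _; exact: quad_continuous.
Qed.

Lemma prox_term_extends : extends Q prox_term
  (fun x => (a%:E * psi x + (2^-1 * pnorm B (x - c) ^+ 2)%:E)%E).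
Proof.
split=> x Qx; first by rewrite psiE.1.
by rewrite (psiE.2 x Qx) gt0_muley ?lte_fin.
Qed.

End ProxTerm.

Section Scheme.
Context {R : realType} {n : nat} {B : 'M[R]_n} {Q : set 'rV[R]_n}.
Context {f p : 'rV[R]_n -> R} {psi : 'rV[R]_n -> \bar R}.
Context {M Rad A0 gamma : R} {x0 xs : 'rV[R]_n}.
Hypotheses (hB : self_adjoint_posdef B) (sQ : segment_closed Q).
Hypotheses (smf : thrice_differentiable_on Q f) (cf : convex_mod B 0 Q f).
Hypotheses (M0 : 0 < M) (qsc : quasi_self_concordant B Q M f).
Hypotheses (cp : convex_mod B 0 Q p) (clp : closed_sublevels Q p).
Hypotheses (psiE : extends Q p psi).
Hypotheses (Rad0 : 0 < Rad) (A00 : 0 < A0) (g0 : 0 < gamma) (g1 : gamma < 1).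
Hypothesis (Qx0 : Q x0).
Implicit Types (s u w y z h : 'rV[R]_n) (x v : nat -> 'rV[R]_n).

Let A := scheme_A A0 gamma.
Let a k := scheme_a A0 gamma k.
Let nu := scheme_nu Rad.
Let F y := f y + p y.

Lemma scheme_A_gt0 k : 0 < A k.
Proof.
elim: k => [//|k IH]; rewrite /A /scheme_A /= mulr_gt0 // invr_gt0.
by rewrite subr_gt0.
Qed.

Lemma scheme_A_recl k : (1 - gamma) * A k.+1 = A k.
Proof. by rewrite /A /scheme_A /= mulVKf // gt_eqF // subr_gt0. Qed.

Lemma scheme_aE k : a k.+1 = gamma * A k.+1.
Proof. by rewrite /a /scheme_a /= mulrA. Qed.

Lemma scheme_a_gt0 k : 0 < a k.+1.
Proof. by rewrite scheme_aE mulr_gt0 // scheme_A_gt0. Qed.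

Lemma scheme_nu_gt0 k : 0 < nu k.+1.
Proof. by rewrite /nu /scheme_nu divr_gt0 // exprn_gt0. Qed.

Lemma mixE y z : gamma *: y + (1 - gamma) *: z = z + gamma *: (y - z).
Proof. by apply/rowP => i; rewrite !mxE; ring. Qed.

Lemma mix_in y z : Q y -> Q z -> Q (gamma *: y + (1 - gamma) *: z).
Proof.
move=> Qy Qz; rewrite mixE; by apply: sQ => //; rewrite !ltW.
Qed.

Lemma mix_ball y z (D : R) : pnorm B (y - xs) <= D -> pnorm B (z - xs) <= D ->
  pnorm B (gamma *: y + (1 - gamma) *: z - xs) <= D.
Proof.
move=> yD zD.
have -> : gamma *: y + (1 - gamma) *: z - xs =
    gamma *: (y - xs) + (1 - gamma) *: (z - xs).
  by apply/rowP => i; rewrite !mxE; ring.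
have g1' : 0 <= 1 - gamma by rewrite subr_ge0 ltW.
apply: le_trans (pnormD hB _ _) _.
rewrite !pnormZ (ger0_norm (ltW g0)) (ger0_norm g1').
by have := ler_wpM2l (ltW g0) yD; have := ler_wpM2l g1' zD; lra.
Qed.

Definition sub_f k z := scheme_f f A0 gamma k z.
Definition sub_p k w := prox_term (B := B) (p := p) (a k.+1) w.

Section Subproblem.
Variables (k : nat) (z w : 'rV[R]_n).
Hypothesis Qz : Q z.

Let Qhom y : Q y -> Q (homothety gamma ((1 - gamma) *: z) y).
Proof. by move=> Qy; exact: mix_in. Qed.

Lemma sub_smooth : thrice_differentiable_on Q (sub_f k z).
Proof.
have [U [oU QU dU]] := smf.
exact: (smooth_pullback (A k.+1) oU dU QU Qhom).
Qed.

Lemma sub_convex : convex_mod B 0 Q (sub_f k z).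
Proof. exact: (convex_pullback Qhom (ltW (scheme_A_gt0 k.+1)) cf). Qed.

Lemma sub_qsc : quasi_self_concordant B Q (gamma * M) (sub_f k z).
Proof.
have [U [oU QU dU]] := smf.
exact: (qsc_pullback oU dU QU Qhom (ltW (scheme_A_gt0 k.+1)) (ltW g0) qsc).
Qed.

Lemma sub_grad y : Q y -> grad (sub_f k z) y =
  (A k.+1 * gamma) *: grad f (gamma *: y + (1 - gamma) *: z).
Proof.
move=> Qy; have [U [oU QU dU]] := smf.
exact: (grad_pullback (A k.+1) dU (QU _ (Qhom Qy))).
Qed.

Lemma sub_p_convex : convex_mod B 1 Q (sub_p k w).
Proof. exact: (prox_term_convex hB cp w (scheme_a_gt0 k)). Qed.

Lemma sub_p_closed : closed_sublevels Q (sub_p k w).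
Proof. exact: (prox_term_closed hB clp (scheme_a_gt0 k) Qz). Qed.

Lemma sub_p_extends : extends Q (sub_p k w) (scheme_psi B psi A0 gamma k w).
Proof. exact: (prox_term_extends psiE w (scheme_a_gt0 k)). Qed.

Let gM0 : 0 < gamma * M. Proof. exact: mulr_gt0. Qed.

Lemma inner_run_spec s (J : nat) out :
  scheme_inner_run B f psi M Rad A0 gamma k z w s J out ->
  (exists2 s', subgrad Q (fun y => sub_f k z y + sub_p k w y) out s' &
     dnorm B s' <= nu k.+1) /\
  forall u : R, 1 <= u -> dnorm B s <= nu k.+1 * u ->
    J%:R <= 2 + 16 * (gamma * M) ^+ 2 *
      (pnorm B (out - w) + 5 * nu k.+1) ^+ 2 + 2 * ln u.
Proof.
exact: (dual_newton_run_spec hB sQ sub_smooth sub_convex gM0 sub_qsc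
  sub_p_convex sub_p_closed sub_p_extends (scheme_nu_gt0 k)).
Qed.

Lemma inner_run_terminates s :
  subgrad Q (fun y => sub_f k z y + sub_p k w y) w s ->
  exists J out, scheme_inner_run B f psi M Rad A0 gamma k z w s J out.
Proof.
exact: (dual_newton_terminates hB sQ sub_smooth sub_convex gM0 sub_qsc
  sub_p_convex sub_p_closed sub_p_extends (scheme_nu_gt0 k)).
Qed.

Lemma sub_subdiff y s :
  subdiff (composite (scheme_f f A0 gamma k z) (scheme_psi B psi A0 gamma k w))
    y s
  <-> subgrad Q (fun y => sub_f k z y + sub_p k w y) y s.
Proof. by apply: extends_subdiff; apply: extends_add; exact: sub_p_extends. Qed.

Lemma sub_subgrad_split y s :
  subgrad Q (fun y => sub_f k z y + sub_p k w y) y s ->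
  exists2 s', subgrad Q p y s' & s = (A k.+1 * gamma) *:
     (grad f (gamma *: y + (1 - gamma) *: z) + s') + (y - w) *m B.
Proof.
move=> sy; have Qy := sy.1; have [df _ _] := smooth_diff sub_smooth Qy.
have p0 := convex_mod_weak ler01 sub_p_convex.
have := subgrad_split_diff sQ p0 df sy.
move=> /(prox_term_subgrad_split hB sQ cp (scheme_a_gt0 k))[s' sy' E].
exists s' => //; rewrite scalerDr -sub_grad // -addrA.
rewrite [A _ * _]mulrC -scheme_aE -E.
by rewrite [RHS]addrC subrK.
Qed.

Lemma sub_subgrad y s : subgrad Q p y s ->
  exists s', subgrad Q (fun y => sub_f k z y + sub_p k w y) y s'.
Proof.
move=> sy; have [df _ _] := smooth_diff sub_smooth sy.1.
eexists; apply: subgradD (subgrad_grad sQ (lexx 0) sub_convex sy.1 df) _.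
exact: (prox_term_subgrad hB w (scheme_a_gt0 k) sy).
Qed.

(** Evaluate at [xs] the strong convexity inequality of the subproblem at its
    approximate minimizer [v'], and use the convexity of [f] at [xs] and [z],
    and that of [p] at [v'] and [z]. *)
Lemma scheme_progress (v' z' : 'rV[R]_n) s (m : R) :
  z' = gamma *: v' + (1 - gamma) *: z -> min_on Q F xs ->
  subgrad Q (fun y => sub_f k z y + sub_p k w y) v' s -> dnorm B s <= m ->
  pnorm B (v' - w) ^+ 2 + (2 * A k.+1 * (F z' - F xs) + pnorm B (v' - xs) ^+ 2)
   - (2 * A k * (F z - F xs) + pnorm B (w - xs) ^+ 2)
   <= 2 * m * pnorm B (v' - xs).
Proof.
move=> z'E [Qxs mxs] sv' sm.
have cS := convex_modD sub_convex sub_p_convex; rewrite add0r in cS.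
have := subgrad_strong sQ cS sv' Qxs.
rewrite /sub_f /scheme_f -z'E /sub_p /prox_term -/(A _) scheme_aE.
have Qv' := sv'.1.
have cmix q : convex_mod B 0 Q q -> forall y, Q y ->
    q (gamma *: y + (1 - gamma) *: z) <= gamma * q y + (1 - gamma) * q z.
  move=> cq y Qy; have g01 : 0 <= gamma <= 1 by rewrite !ltW.
  have := cq _ _ _ Qz Qy g01.
  rewrite -mixE.
  by lra.
have f1 := cmix _ cf _ Qxs; have p1 := cmix _ cp _ Qv'.
have A1 := scheme_A_gt0 k.+1; have A2 := scheme_A_recl k.
have := pair_le hB s (- (xs - v')); rewrite pairNr pnormN => sle.
have {}sle := le_trans sle (ler_wpM2r (pnorm_ge0 _) sm).
rewrite (pnorm_distC xs v') in sle *; rewrite (pnorm_distC w xs).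
have := ler_wpM2l (ltW A1) f1; have := ler_wpM2l (ltW A1) p1.
rewrite -z'E /F -A2.
move: (f z') (p z') (f xs) (p xs) (f z) (p z) (p v') (f (_ + _)) => *.
lra.
Qed.

End Subproblem.

Section Run.
Variables (x v : nat -> 'rV[R]_n) (I : nat -> nat).

Definition run_of K := scheme_run B f psi M x0 Rad A0 gamma K x v I.

Lemma run_ofW K k : (k <= K)%N -> run_of K -> run_of k.
Proof.
by move=> kK [xE vE it]; split=> // j jk; apply: it; exact: leq_trans kK.
Qed.

Lemma run_points K : run_of K -> forall k, (k <= K)%N ->
  [/\ Q (x k), Q (v k) & (0 < k)%N -> exists s, subgrad Q p (v k) s].
Proof.
move=> [xE vE it]; elim=> [_|k IH kK]; first by rewrite xE vE.
have [Qx _ _] := IH (ltnW kK); have [[s run] ->] := it k kK.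
have [[s' sv _] _] := inner_run_spec Qx run.
have Qv := sv.1; split=> //; first exact: mix_in.
by move=> _; have [s2 sv2 _] := sub_subgrad_split Qx sv; exists s2.
Qed.

Hypothesis ms : min_on Q F xs.

(** Normalized so that its part at [v k] is a squared norm: [fejer_bound] applies
    to its square roots. *)
Definition potential k := 2 * A k * (F (x k) - F xs) + pnorm B (v k - xs) ^+ 2.

Lemma run_gap_ge0 K : run_of K -> forall k, (k <= K)%N -> 0 <= F (x k) - F xs.
Proof.
by move=> run k kK; have [Qx _ _] := run_points run kK; rewrite subr_ge0 ms.2.
Qed.

(** The Fejer bound for the square roots of the potentials, with
    [2 * Rad] bounding the sum of the tolerances. *)
Lemma run_potential K (D : R) : run_of K ->
  Num.sqrt (potential 0) + 4 * Rad <= D ->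
  [/\ \sum_(0 <= k < K) pnorm B (v k.+1 - v k) ^+ 2 <= D ^+ 2,
      2 * A K * (F (x K) - F xs) <= D ^+ 2 & pnorm B (v K - xs) <= D].
Proof.
move=> run VD; pose d k := Num.sqrt (potential k).
have gap0 k : (k <= K)%N -> 0 <= 2 * A k * (F (x k) - F xs).
  move=> kK; apply: mulr_ge0; last exact: (run_gap_ge0 run kK).
  by rewrite mulr_ge0 // ltW // scheme_A_gt0.
have V0 k : (k <= K)%N -> 0 <= potential k.
  by move=> kK; rewrite addr_ge0 ?sqr_ge0 // gap0.
have d0 k : 0 <= d k by exact: sqrtr_ge0.
have dE k : (k <= K)%N -> d k ^+ 2 = potential k.
  by move=> kK; apply: sqr_sqrtr; exact: V0.
have nu0 k : 0 <= nu k.+1 by rewrite ltW // scheme_nu_gt0.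
have Dd k : (k <= K)%N -> pnorm B (v k - xs) <= d k.
  move=> kK; rewrite -[leLHS]ger0_norm ?pnorm_ge0 // -sqrtr_sqr ler_sqrt ?V0 //.
  by rewrite lerDr gap0.
have step k : (k < K)%N ->
    pnorm B (v k.+1 - v k) ^+ 2 + d k.+1 ^+ 2 - d k ^+ 2 <= 2 * nu k.+1 * d
      k.+1.
  move=> kK; rewrite (dE _ kK) (dE _ (ltnW kK)).
  have [Qx _ _] := run_points run (ltnW kK).
  have [_ _ it] := run; have [[s ir] xE] := it k kK.
  have [[s' sv le_s] _] := inner_run_spec Qx ir.
  apply: le_trans (scheme_progress Qx xE ms sv le_s) _.
  by rewrite ler_wpM2l ?Dd // mulr_ge0.
have fj := fejer_bound d0 nu0 step (leqnn K).
have D2 : (d 0%N + 2 * \sum_(0 <= k < K) nu k.+1) ^+ 2 <= D ^+ 2.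
  have e0 : 0 <= \sum_(0 <= k < K) nu k.+1 by apply: sumr_ge0.
  have a0 : 0 <= d 0%N + 2 * \sum_(0 <= k < K) nu k.+1.
    by rewrite addr_ge0 // mulr_ge0.
  have aD : d 0%N + 2 * \sum_(0 <= k < K) nu k.+1 <= D.
    by have := sum_step_le K (ltW Rad0); rewrite /nu /scheme_nu /d; lra.
  by rewrite ler_pXn2r ?nnegrE // (le_trans a0).
have D0 : 0 <= D by apply: le_trans VD;
  rewrite addr_ge0 ?d0 ?mulr_ge0 ?(ltW Rad0).
have {fj}fj := le_trans fj D2.
have S0 : 0 <= \sum_(0 <= k < K) pnorm B (v k.+1 - v k) ^+ 2.
  by apply: sumr_ge0 => k _; exact: sqr_ge0.
rewrite (dE _ (leqnn K)) in fj; have gK := gap0 K (leqnn K).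
have nK := sqr_ge0 (pnorm B (v K - xs)).
rewrite /potential in fj; split; try lra.
by rewrite -(@ler_pXn2r _ 2) ?nnegrE ?pnorm_ge0 //; lra.
Qed.

Lemma run_ball K (D : R) : run_of K ->
  Num.sqrt (potential 0) + 4 * Rad <= D ->
  forall k, (k <= K)%N -> pnorm B (x k - xs) <= D.
Proof.
move=> run VD; elim=> [_|k IH kK].
  have [xE vE _] := run; rewrite xE -vE.
  by have [] := run_potential (run_ofW (leq0n K) run) VD.
have {IH}xk := IH (ltnW kK).
have [_ _ vk] := run_potential (run_ofW kK run) VD.
have [_ _ it] := run; have [_ ->] := it k kK.
exact: mix_ball.
Qed.

End Run.

(** The last Newton step of the previous subproblem provides a subgradient of
    [psi] at [v K], hence one of the next objective. *)
Lemma scheme_is_well_defined : scheme_well_defined B f psi M x0 Rad A0 gamma.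
Proof.
move=> K x v I run /=; have [Qx Qv sv] := run_points run (leqnn K).
split=> [/sv[s sp]|s /sub_subdiff].
  have [s' ss'] := sub_subgrad K (v K) Qx sp.
  by exists s'; apply/sub_subdiff.
exact: inner_run_terminates.
Qed.

End Scheme.

(** * Extended-valued convex functions and the operator norm *)

Section OperatorNorm.
Context {R : realType} {n : nat} {B : 'M[R]_n}.
Hypothesis hB : self_adjoint_posdef B.
Implicit Types (h : 'rV[R]_n) (A : 'M[R]_n).

(** This makes the supremum defining the operator norm finite. *)
Lemma pnorm_mulmx_bounded A :
  exists2 K : R, 0 <= K & forall h, pnorm B (h *m A) <= K * pnorm B h.
Proof.
have [K1 K10 h1] := norm_le_pnorm hB; have [K2 K20 h2] := pnorm_le_norm hB.
pose S := \sum_j \sum_i `|A i j|.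
have S0 : 0 <= S by do 2!(apply: sumr_ge0 => ? _).
exists (K2 * (S * K1)) => [|h]; first by rewrite !mulr_ge0 // ltW.
apply: le_trans (h2 _) _; rewrite -mulrA ler_pM2l // -mulrA.
apply: (@le_trans _ _ (S * `|h|)); last by rewrite ler_wpM2l.
apply: norm_le_coord => [|j]; first by rewrite mulr_ge0.
have Sj : \sum_i `|A i j| <= S.
  by rewrite /S [leRHS](bigD1 j) //= lerDl sumr_ge0 // => k _; exact: sumr_ge0.
apply: le_trans (ler_wpM2r (normr_ge0 h) Sj).
rewrite mxE (le_trans (ler_norm_sum _ _ _)) // mulr_suml ler_sum // => i _.
by rewrite normrM mulrC ler_wpM2l // coord_le.
Qed.

Lemma dnorm_mulmx_le A h : dnorm B (h *m A) <= opnorm B A * pnorm B h.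
Proof.
have [->|hn0] := eqVneq h 0.
  by rewrite mul0mx pnorm0 mulr0 dnormE // mul0mx pnorm0.
have p0 := pnorm_gt0 hB hn0.
have [K K0 hK] := pnorm_mulmx_bounded (A *m invmx B).
rewrite -ler_pdivrMr //; apply: sup_ubound.
  exists K => _ [u /= u1 <-]; rewrite dnormE // -mulmxA (le_trans (hK _)) //.
  by rewrite ler_piMr.
exists ((pnorm B h)^-1 *: h) => /=.
  by rewrite pnormZ ger0_norm ?invr_ge0 ?(ltW p0) // mulVf ?gt_eqF.
by rewrite -scalemxAl dnormZ // ger0_norm ?invr_ge0 ?(ltW p0) // mulrC.
Qed.

Lemma opnorm_ge0 A : 0 <= opnorm B A.
Proof.
have [K K0 hK] := pnorm_mulmx_bounded (A *m invmx B).
apply: (@le_trans _ _ (dnorm B (0 *m A))); first exact: dnorm_ge0.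
apply: sup_ubound; last by exists 0 => //=; rewrite pnorm0.
exists K => _ [u /= u1 <-]; rewrite dnormE // -mulmxA (le_trans (hK _)) //.
by rewrite ler_piMr.
Qed.

End OperatorNorm.

Section ConvexProper.
Context {R : realType} {n : nat}.
Implicit Types (x y : 'rV[R]_n) (psi : 'rV[R]_n -> \bar R).

Lemma proper_extends psi : closed_convex_proper psi ->
  extends (edom psi) (fine \o psi) psi.
Proof.
move=> [lb _ _ _]; split=> x; rewrite /edom /= => Qx.
  by rewrite fineK // fin_numE gt_eqF ?lb // lt_eqF.
by move/negP: Qx; rewrite -leNgt leye_eq => /eqP.
Qed.

Lemma segmentE x y (t : R) : x + t *: (y - x) = (1 - t) *: x + (1 - (1 - t)) *:
  y.
Proof. by apply/rowP => i; rewrite !mxE; ring. Qed.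

Lemma proper_segment psi : closed_convex_proper psi ->
  segment_closed (edom psi).
Proof.
move=> hpsi x y t Qx Qy /andP[t0 t1]; have [E _] := proper_extends hpsi.
have [_ _ _ cvx] := hpsi.
have t01 : 0 <= 1 - t <= 1 by lra.
rewrite /edom /= segmentE; apply: le_lt_trans (cvx _ _ _ t01) _.
by rewrite E // E // -!EFinM -EFinD ltry.
Qed.

Lemma proper_convex (B : 'M[R]_n) psi : closed_convex_proper psi ->
  convex_mod B 0 (edom psi) (fine \o psi).
Proof.
move=> hpsi x y t Qx Qy t01; have [E _] := proper_extends hpsi.
have [_ _ _ cvx] := hpsi.
have Qz := proper_segment hpsi Qx Qy t01.
have t01' : 0 <= 1 - t <= 1 by lra.
have := cvx x y _ t01'; rewrite -segmentE !E // -!EFinM -EFinD lee_fin /=.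
lra.
Qed.

Lemma proper_closed psi : closed_convex_proper psi ->
  closed_sublevels (edom psi) (fine \o psi).
Proof.
move=> hpsi m; have [E1 E2] := proper_extends hpsi; have [_ _ lsc _] := hpsi.
have -> : [set x | edom psi x /\ (fine \o psi) x <= m] =
    ~` [set x | (m%:E < psi x)%E].
  apply/seteqP; split=> x /=.
    by move=> [Qx xm]; apply/negP; rewrite -leNgt E1 // lee_fin.
  move/negP; rewrite -leNgt => xm.
  have Qx : edom psi x by rewrite /edom /= (le_lt_trans xm) // ltry.
  by split=> //; rewrite E1 // lee_fin in xm.
by apply: open_closedC; exact: (lower_semicontinuousP psi).1.
Qed.

Lemma convex_function_mod (B : 'M[R]_n) (Q : set 'rV[R]_n) (f : 'rV[R]_n -> R) :
  convex_function Q f -> convex_mod B 0 Q f.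
Proof.
move=> cf x y t Qx Qy /andP[t0 t1].
have s0 : 0 <= 1 - t by lra.
have s1 : 1 - t <= 1 by lra.
have : f ((1 - t) *: x + (1 - (1 - t)) *: y) <=
    (1 - t) * f x + (1 - (1 - t)) * f y.
  by apply: (cf (Itv01 s0 s1)); rewrite inE.
rewrite segmentE; lra.
Qed.

End ConvexProper.

(** * Arithmetic of the parameters *)

Section ScalingArithmetic.
Context {R : realType}.
Implicit Types (c gap eps y : R).

Lemma powR23_cube y : 0 <= y -> (y `^ (2 / 3)) ^+ 3 = y ^+ 2.
Proof.
move=> y0; rewrite -[LHS]powR_mulrn ?powR_ge0 // -powRrM.
rewrite (_ : 2 / 3 * 3%:R = 2%:R); last by field.
by rewrite powR_mulrn.
Qed.

Lemma powR23_ge2 (M Rad : R) : 0 < M -> 2 `^ (3 / 2) / M <= Rad ->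
  2 <= (M * Rad) `^ (2 / 3).
Proof.
move=> M0; rewrite ler_pdivrMr // [Rad * M]mulrC => MR.
have E : (2 : R) = (2 `^ (3 / 2)) `^ (2 / 3).
  by rewrite -powRrM (_ : 3 / 2 * (2 / 3) = 1) ?powRr1 //; field.
rewrite [leLHS]E; apply: ge0_ler_powR => //; rewrite ?nnegrE ?powR_ge0 //.
by rewrite (le_trans _ MR) ?powR_ge0.
Qed.

Lemma lnO_ge1 y : 1 <= lnO y. Proof. by rewrite /lnO le_max lexx. Qed.

Lemma ln_max1_le_lnO y : ln (Num.max 1 y) <= lnO y.
Proof.
rewrite /lnO; have [y1|y1] := leP 1 y; rewrite le_max; first
  by rewrite lexx orbT.
by rewrite ln1 ler01.
Qed.

(** Since [1 - 1 / P <= expR (- 1 / P)], about [P] times the logarithm of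
    [kappa / eps] iterations suffice. *)
Lemma iterations_for_accuracy (P kappa eps : R) : 2 <= P -> 1 <= kappa ->
  0 < eps < 1 -> exists2 k : nat,
    k%:R <= (2 + ln kappa) * (P * lnO (1 / eps)) &
    kappa * (1 - 1 / P) ^+ k <= eps.
Proof.
move=> P2 k1 /andP[e0 e1]; have P0 : 0 < P by lra.
have lk : 0 <= ln kappa by rewrite ln_ge0.
have ie : 1 <= 1 / eps by rewrite ler_pdivlMr // mul1r ltW.
have le : 0 <= ln (1 / eps) by rewrite ln_ge0.
set t := P * (ln (1 / eps) + ln kappa).
have t0 : 0 <= t by rewrite mulr_ge0 ?addr_ge0 // ltW.
exists (Num.truncn t).+1.
  have W1 := lnO_ge1 (1 / eps).
  have Wl : ln (1 / eps) <= lnO (1 / eps) by rewrite /lnO le_max lexx orbT.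
  have tt : (Num.truncn t)%:R <= t by rewrite truncn_le.
  rewrite -natr1; apply: le_trans (lerD tt (lexx 1)) _.
  have PW : P <= P * lnO (1 / eps) by rewrite ler_peMr // ltW.
  have H1 : P * ln (1 / eps) <= P * lnO (1 / eps) by rewrite ler_wpM2l // ltW.
  have H2 : ln kappa * P <= ln kappa * (P * lnO (1 / eps)) by rewrite ler_wpM2l.
  by rewrite /t; lra.
set k := (Num.truncn t).+1.
have kt : t < k%:R by rewrite truncnS_gt.
have le1 : (1 - 1 / P) ^+ k <= expR (k%:R * - (1 / P)).
  rewrite expRM_natl ler_pXn2r ?nnegrE ?expR_ge0 //.
    by have := expR_ge1Dx (- (1 / P)); lra.
  by rewrite subr_ge0 ler_pdivrMr // mul1r; lra.
have k0 : 0 < kappa := lt_le_trans ltr01 k1.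
apply: le_trans (ler_wpM2l (ltW k0) le1) _.
have -> : eps = kappa * expR (- ln (1 / eps) - ln kappa).
  rewrite expRD !expRN !lnK ?posrE ?divr_gt0 //.
  by field; rewrite !gt_eqF.
rewrite ler_pM2l // ler_expR -opprD mulrN lerN2.
by rewrite [1 / P]mul1r ler_pdivlMr // mulrC ltW.
Qed.

End ScalingArithmetic.

Section Accounting.
Context {R : realType}.

(** The initial ratio of the subgradient norm to the tolerance, in terms of the
    argument [X] of the logarithm. Writing [Y] for
    [Rad / gap * (Num.sqrt (L * F0) + Lpsi)], the term in [Lpsi] is linear in
    [Y] and the term in [L] is quadratic: [Rad / gap * L * Rad <= Y ^+ 2]
    because [gap <= F0]. The exponent 2 only costs a factor 2 in the
    logarithm. *)
Lemma start_ratio_le (c Rad P eps gap L Lpsi F0 C0 W0 kk A X : R) :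
  0 < c -> 0 < Rad -> 2 <= P -> 0 < eps < 1 -> 0 < gap -> 0 <= L -> 0 <= Lpsi ->
  gap <= F0 -> 1 <= W0 -> 0 < kk -> kk <= C0 * (P * W0) -> 0 <= A ->
  A * eps * gap <= ((5 + c) * Rad) ^+ 2 ->
  X = P * Rad / gap * (Num.sqrt (L * F0) + Lpsi) * (1 / eps * W0 ^+ 2) ->
  A * (1 / P) * (2 * Lpsi + L * ((5 + c) * Rad)) <=
    Rad / kk ^+ 2 * ((5 + c) ^+ 2 * C0 ^+ 2 * (7 + c) * Num.max 1 X ^+ 2).
Proof.
move=> c0 R0 P2 /andP[e0 e1] gap0 L0 Lp0 gF W1 k0 kC A0 hA Xdef.
have P0 : 0 < P by lra.
pose q := Rad / gap; have q0 : 0 < q by rewrite divr_gt0.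
pose W := 1 / eps * W0 ^+ 2.
have W0sq : 1 <= W0 ^+ 2 by rewrite exprn_ege1.
have Wge1 : 1 <= W.
  by rewrite /W -[leLHS]mulr1 ler_pM // ler_pdivlMr // mul1r ltW.
pose S := Num.sqrt (L * F0); have S0 : 0 <= S by exact: sqrtr_ge0.
pose Y := q * (S + Lpsi).
have Y0 : 0 <= Y by apply: mulr_ge0 (ltW q0) _; exact: addr_ge0.
have XE : X = P * W * Y by rewrite Xdef /Y /q /W -/S; field; rewrite !gt_eqF.
have qLR : q * L * Rad <= Y ^+ 2.
  have S2 : L * gap <= S ^+ 2.
    by rewrite sqr_sqrtr ?mulr_ge0 ?ler_wpM2l // (le_trans (ltW gap0)).
  have -> : q * L * Rad = q ^+ 2 * (L * gap) by rewrite /q; field;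
    rewrite gt_eqF.
  apply: (@le_trans _ _ (q ^+ 2 * S ^+ 2)); first by rewrite ler_wpM2l ?sqr_ge0.
  have qS0 : 0 <= q * S by exact: mulr_ge0 (ltW q0) S0.
  have qSY : q * S <= Y by apply: ler_wpM2l; [exact: ltW | rewrite lerDl].
  by rewrite -exprMn ler_pXn2r ?nnegrE.
have qLp : q * Lpsi <= Y by apply: ler_wpM2l; [exact: ltW | rewrite lerDr].
clearbody Y; set m := Num.max 1 X.
have m1 : 1 <= m by rewrite le_max lexx.
have mX : X <= m by rewrite le_max lexx orbT.
have PW1 : 1 <= P * W by apply: (@le_trans _ _ (2 * 1)); [lra | rewrite ler_pM].
have X0 : 0 <= X by rewrite XE mulr_ge0 // (le_trans ler01).
have X2 : P * W * Y ^+ 2 <= X ^+ 2.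
  by rewrite XE exprMn ler_wpM2r ?sqr_ge0 // expr2 ler_peMr // (le_trans ler01).
have mm : X <= m ^+ 2
  by rewrite (le_trans mX) // expr2 ler_peMr // (le_trans ler01).
have mm2 : X ^+ 2 <= m ^+ 2 by rewrite ler_pXn2r ?nnegrE // (le_trans X0).
have bracket : P * W * (2 * (q * Lpsi) + (5 + c) * (q * L * Rad))
    <= (7 + c) * m ^+ 2.
  have PW0 : 0 <= P * W by rewrite (le_trans ler01).
  have h1 : P * W * (q * Lpsi) <= X by rewrite XE ler_wpM2l.
  have h2 : P * W * (q * L * Rad) <= X ^+ 2.
    by apply: (le_trans _ X2); apply: ler_wpM2l.
  have h3 : (5 + c) * (P * W * (q * L * Rad)) <= (5 + c) * m ^+ 2.
    by rewrite ler_wpM2l ?(le_trans h2) //; lra.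
  by lra.
have kk2 : 0 < kk ^+ 2 by rewrite exprn_gt0.
rewrite [leRHS]mulrAC ler_pdivlMr //.
have k2 : kk ^+ 2 <= C0 ^+ 2 * (P ^+ 2 * W0 ^+ 2).
  rewrite -!exprMn ler_pXn2r ?nnegrE ?(ltW k0) //.
  exact: le_trans (ltW k0) kC.
set T := 2 * Lpsi + _; have T0 : 0 <= T.
  by rewrite addr_ge0 ?mulr_ge0 ?(ltW R0) //; lra.
have A1 : A <= (5 + c) ^+ 2 * Rad * q / eps.
  rewrite ler_pdivlMr // -(ler_pM2r gap0) (le_trans hA) // exprMn /q.
  by rewrite le_eqVlt; apply/orP; left; apply/eqP; field; rewrite gt_eqF.
have iP0 : 0 <= 1 / P * T by rewrite mulr_ge0 // divr_ge0 // ltW.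
apply: (@le_trans _ _ ((5 + c) ^+ 2 * Rad * q / eps * (1 / P * T) *
    (C0 ^+ 2 * (P ^+ 2 * W0 ^+ 2)))).
  rewrite -(mulrA A); apply: ler_pM => //; [|exact: ltW|].
    by rewrite mulr_ge0.
  by rewrite ler_wpM2r.
have -> : (5 + c) ^+ 2 * Rad * q / eps * (1 / P * T) *
    (C0 ^+ 2 * (P ^+ 2 * W0 ^+ 2)) =
    (5 + c) ^+ 2 * C0 ^+ 2 * Rad *
    (P * W * (2 * (q * Lpsi) + (5 + c) * (q * L * Rad))).
  by rewrite /T /W; field; rewrite !gt_eqF.
have -> : Rad * ((5 + c) ^+ 2 * C0 ^+ 2 * (7 + c) * m ^+ 2) =
   (5 + c) ^+ 2 * C0 ^+ 2 * Rad * ((7 + c) * m ^+ 2) by ring.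
rewrite ler_wpM2l // mulr_ge0 ?(ltW R0) //.
by apply: mulr_ge0; exact: sqr_ge0.
Qed.

(** Of the two terms of each inner count, the displacements are summable over
    the whole run, and only the logarithm is paid at every iteration. *)
Lemma total_count_le (k : nat) (I : nat -> nat) (C0 P W0 calL lK Q2 b : R)
    (r : nat -> R) :
  1 <= P -> 1 <= W0 -> 1 <= calL -> 0 <= lK -> 0 <= C0 -> 0 <= b ->
  k%:R <= C0 * (P * W0) ->
  (forall j, (j < k)%N -> (I j.+1)%:R <= 2 + b * r j + 2 * (lK + 2 * calL)) ->
  b * \sum_(0 <= j < k) r j <= Q2 * P -> 0 <= Q2 ->
  (\sum_(1 <= i < k.+1) I i)%:R <= (C0 * (6 + 2 * lK) + Q2) * (P * W0 * calL)
    :> R.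
Proof.
move=> P1 W1 L1 lK0 C00 b0 kC hI hS Q20.
rewrite big_add1 /= natr_sum.
have le1 : \sum_(0 <= j < k) (I j.+1)%:R <=
    \sum_(0 <= j < k) ((6 + 2 * lK) * calL + b * r j).
  rewrite big_nat [leRHS]big_nat; apply: ler_sum => j /andP[_ jk].
  apply: le_trans (hI j jk) _.
  have : lK <= lK * calL by rewrite ler_peMr.
  lra.
apply: (le_trans le1); rewrite big_split /= sumr_const_nat subn0.
rewrite -[X in X + _]mulr_natr -mulr_sumr [leRHS]mulrDl.
have P0 : 0 <= P by lra.
have L0 : 0 <= calL by lra.
apply: lerD.
  have -> : C0 * (6 + 2 * lK) * (P * W0 * calL) =
      (6 + 2 * lK) * calL * (C0 * (P * W0)) by ring.
  by rewrite ler_wpM2l // mulr_ge0 // addr_ge0 // mulr_ge0.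
apply: (le_trans hS); rewrite ler_wpM2l //.
have PW : P <= P * W0 by rewrite ler_peMr.
by apply: (le_trans PW); rewrite ler_peMr // (le_trans P0).
Qed.

End Accounting.

(** * Iteration counts of the scheme *)

Section Complexity.
Context {R : realType} {n : nat} {B : 'M[R]_n} {Q : set 'rV[R]_n}.
Context {f p : 'rV[R]_n -> R} {psi : 'rV[R]_n -> \bar R}.
Context {M Rad A0 gamma c : R} {x0 xs : 'rV[R]_n}.
Hypotheses (hB : self_adjoint_posdef B) (sQ : segment_closed Q).
Hypotheses (smf : thrice_differentiable_on Q f) (cf : convex_mod B 0 Q f).
Hypotheses (M0 : 0 < M) (qsc : quasi_self_concordant B Q M f).
Hypotheses (cp : convex_mod B 0 Q p) (clp : closed_sublevels Q p).
Hypotheses (psiE : extends Q p psi).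
Hypotheses (Rad0 : 0 < Rad) (A00 : 0 < A0) (g0 : 0 < gamma) (g1 : gamma < 1).
Hypothesis (Qx0 : Q x0).

Let F y := f y + p y.
Let A := scheme_A A0 gamma.
Let D := (5 + c) * Rad.
Let gap0 := F x0 - F xs.

Hypotheses (ms : min_on Q F xs) (c0 : 0 < c) (gap0_gt0 : 0 < gap0).
Hypotheses (A0E : 2 * A0 * gap0 = c ^+ 2 * Rad ^+ 2) (x0R : pnorm B (x0 - xs)
  <= Rad).

Variables (x v : nat -> 'rV[R]_n) (I : nat -> nat).
Hypothesis run : forall K, scheme_run B f psi M x0 Rad A0 gamma K x v I.

Let points K := run_points hB sQ smf cf M0 qsc cp clp psiE Rad0 A00 g0 g1 Qx0
  (run K) (leqnn K).

(** The choice of [A0] makes the initial potential at most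
    [((1 + c) * Rad) ^+ 2]. *)
Lemma initial_potential_le :
  Num.sqrt (potential (B := B) (f := f) (p := p) (A0 := A0) (gamma := gamma)
    (xs := xs) x v 0) + 4 * Rad <= D.
Proof.
have [xE vE _] := run 0.
have -> : D = (1 + c) * Rad + 4 * Rad by rewrite /D; ring.
have r0 : 0 <= (1 + c) * Rad by rewrite mulr_ge0 ?(ltW Rad0) // addr_ge0 // ltW.
rewrite lerD2r -[leRHS](ger0_norm r0).
rewrite -sqrtr_sqr ler_sqrt ?sqr_ge0 // /potential xE vE /=.
rewrite -/(F x0) -/(F xs) -/gap0 A0E.
have h : pnorm B (x0 - xs) ^+ 2 <= Rad ^+ 2.
  by rewrite ler_pXn2r ?nnegrE ?pnorm_ge0 // ltW.
have := mulr_ge0 (ltW c0) (sqr_ge0 Rad); lra.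
Qed.

Let bounds K := run_potential hB sQ smf cf M0 qsc cp clp psiE Rad0 A00 g0 g1 Qx0
  ms (run K) initial_potential_le.

Lemma run_in_ball k : pnorm B (v k - xs) <= D /\ pnorm B (x k - xs) <= D.
Proof.
split; first by have [] := bounds k.
exact: (run_ball hB sQ smf cf M0 qsc cp clp psiE Rad0 A00 g0 g1 Qx0 ms (run k)
  initial_potential_le (leqnn k)).
Qed.

Lemma gap_decay k : F (x k) - F xs <= ((5 + c) / c) ^+ 2 * (1 - gamma) ^+ k *
  gap0.
Proof.
have [_ gk _] := bounds k.
have AE : (1 - gamma) ^+ k * A k = A0.
  elim: k {gk} => [|k IH]; first by rewrite mul1r.
  by rewrite exprSr -mulrA (scheme_A_recl g1).
have q0 : 0 <= (1 - gamma) ^+ k by rewrite exprn_ge0 // subr_ge0 ltW.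
have := ler_wpM2l q0 gk; rewrite -/(F _) -/(F xs) => H.
have {}H : 2 * A0 * (F (x k) - F xs) <= (1 - gamma) ^+ k * D ^+ 2.
  have -> : 2 * A0 = (1 - gamma) ^+ k * (2 * A k)
    by rewrite -[LHS]mulrC -{1}AE; ring.
  by rewrite -mulrA.
have {H} := ler_wpM2r (ltW gap0_gt0) H.
rewrite mulrAC A0E => H.
have k0 : 0 < c ^+ 2 * Rad ^+ 2 by rewrite mulr_gt0 ?exprn_gt0.
rewrite -(ler_pM2l k0); apply: (le_trans H); rewrite le_eqVlt; apply/orP; left.
by apply/eqP; rewrite /D; field; rewrite gt_eqF.
Qed.

Lemma A_mono i j : (i <= j)%N -> A i <= A j.
Proof.
elim: j => [|j IH]; first by rewrite leqn0 => /eqP ->.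
rewrite leq_eqVlt => /predU1P[-> //|ij]; apply: le_trans (IH ij) _.
rewrite /A -(scheme_A_recl g1 j) ler_piMl ?(ltW (scheme_A_gt0 A00 g1 _)) //.
by rewrite gerBl ltW.
Qed.

(** The potential bounds [2 A (F - F xs)], so that the weights cannot be large
    as long as the gap is large. *)
Lemma A_before_accuracy (eps : R) k : gamma <= 1 / 2 -> 0 < eps ->
  ~ F (x k) - F xs <= eps * gap0 -> A k.+1 * eps * gap0 <= D ^+ 2.
Proof.
move=> g12 e0 /negP; rewrite -ltNge => big; have [_ gk _] := bounds k.
apply: le_trans gk; rewrite -/(F _) -/(F xs) -mulrA.
have Ak : 0 < A k.+1 := scheme_A_gt0 A00 g1 k.+1.
have A2 : A k.+1 <= 2 * A k.
  by rewrite /A -(scheme_A_recl g1 k) -/(A _); nra.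
have eg : 0 <= eps * gap0 by rewrite mulr_ge0 ?ltW.
apply: le_trans (ler_wpM2r eg A2) _.
by rewrite ler_wpM2l ?(ltW big) // mulr_ge0 // ltW // scheme_A_gt0.
Qed.

Section BallConstants.
Variables (L Lpsi : R).
Hypothesis hL : forall y, Q y -> pnorm B (y - xs) <= D ->
  opnorm B (hess f y) <= L.
Hypothesis hpsi : forall y s, Q y -> pnorm B (y - xs) <= D -> subgrad Q p y s ->
  dnorm B s <= Lpsi.

Let D0 : 0 < D. Proof. by rewrite mulr_gt0 // addr_gt0. Qed.

Let center : pnorm B (xs - xs) <= D.
Proof. by rewrite subrr pnorm0 ltW. Qed.

Let L0 : 0 <= L.
Proof. exact: le_trans (opnorm_ge0 hB _) (hL ms.1 center). Qed.

(** By optimality, [- grad f xs] is a subgradient of [p] at [xs]. *)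
Lemma dnorm_grad_opt_le : dnorm B (grad f xs) <= Lpsi.
Proof.
have [df _ _] := smooth_diff smf ms.1.
have := subgrad_split_diff sQ cp df (min_on_subgrad ms); rewrite sub0r => s.
by rewrite -(dnormN hB); exact: (hpsi ms.1 center s).
Qed.

Lemma ball_Lpsi_ge0 : 0 <= Lpsi.
Proof. exact: le_trans (dnorm_ge0 _) dnorm_grad_opt_le. Qed.

Lemma dnorm_grad_ball_le y : Q y -> pnorm B (y - xs) <= D ->
  dnorm B (grad f y) <= Lpsi + L * D.
Proof.
move=> Qy yD.
rewrite -(subrK (grad f xs) (grad f y)) addrC.
apply: le_trans (dnormD hB _ _) _; apply: lerD; first exact: dnorm_grad_opt_le.
apply: le_trans (ler_wpM2l L0 yD).
apply: (dnorm_grad_le hB sQ smf ms.1 Qy L0) => t /[dup] t01 /andP[t0 t1].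
apply: le_trans (dnorm_mulmx_le hB _ _) _; rewrite ler_wpM2r ?pnorm_ge0 //.
apply: hL; first exact: sQ ms.1 Qy t01.
by rewrite addrKl pnormZ ger0_norm // (le_trans _ yD) // ler_piMl // pnorm_ge0.
Qed.

(** Any admissible initial subgradient of the subproblem is a multiple of
    [grad f y + s'] with [s'] a subgradient of [p], since the prox term has
    gradient 0 at its center. *)
Lemma start_subgrad_le k s J out :
  scheme_inner_run B f psi M Rad A0 gamma k (x k) (v k) s J out ->
  dnorm B s <= A k.+1 * gamma * (2 * Lpsi + L * D).
Proof.
move=> [xi [gi [_ [sub0 _] _ _ _]]].
have [Qx Qv _] := points k; have [vD xD] := run_in_ball k.
move/(sub_subdiff psiE A00 g0 g1) in sub0.
have [s' sp ->] := sub_subgrad_split hB sQ smf cp A00 g0 g1 Qx sub0.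
have Ag : 0 <= A k.+1 * gamma
  by rewrite mulr_ge0 ?(ltW g0) // ltW // scheme_A_gt0.
rewrite subrr mul0mx addr0 (dnormZ hB) (ger0_norm Ag); apply: ler_wpM2l => //.
apply: le_trans (dnormD hB _ _) _.
have h1 := dnorm_grad_ball_le (mix_in sQ g0 g1 Qv Qx) (mix_ball hB g0 g1 vD xD).
have h2 := hpsi Qv vD sp.
by lra.
Qed.


End BallConstants.

(** The displacements contribute [(gamma M)^2] times their square sum, which is
    of order [(gamma M Rad)^2 = P]: constant on average over the iterations. *)
Lemma total_inner_iterations (P eps L Lpsi F0 C0 X : R) (k : nat) :
  2 <= P -> gamma = 1 / P -> (gamma * M) ^+ 2 * Rad ^+ 2 = P -> 0 < eps < 1 ->
  (forall y, Q y -> pnorm B (y - xs) <= D -> opnorm B (hess f y) <= L) ->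
  (forall y s, Q y -> pnorm B (y - xs) <= D -> subgrad Q p y s ->
    dnorm B s <= Lpsi) ->
  gap0 <= F0 -> 1 <= C0 -> k%:R <= C0 * (P * lnO (1 / eps)) ->
  (forall j, (j < k)%N -> ~ F (x j) - F xs <= eps * gap0) ->
  X = P * Rad / gap0 * (Num.sqrt (L * F0) + Lpsi) * (1 / eps * lnO (1 / eps) ^+
    2) ->
  (\sum_(1 <= i < k.+1) I i)%:R <=
    (C0 * (6 + 2 * ln ((5 + c) ^+ 2 * C0 ^+ 2 * (7 + c)))
     + 16 * (2 * (5 + c) ^+ 2 + 100)) * (P * lnO (1 / eps) * lnO X).
Proof.
have cpos := c0; move=> P2 gE gP /[dup] e01 /andP[e0 e1] hL hpsi gF C1 kC far
  XE.
have P1 : 1 <= P by lra.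
have W1 := lnO_ge1 (1 / eps).
set K1 := (5 + c) ^+ 2 * C0 ^+ 2 * (7 + c).
have K11 : 1 <= K1.
  have a1 : 1 <= (5 + c) ^+ 2 by rewrite exprn_ege1 //; lra.
  have b1 : 1 <= C0 ^+ 2 by rewrite exprn_ege1.
  have ab : 1 <= (5 + c) ^+ 2 * C0 ^+ 2 by rewrite -[leLHS]mulr1 ler_pM.
  by rewrite /K1 -[leLHS]mulr1 ler_pM //; lra.
have D0 : 0 < D by rewrite mulr_gt0 // addr_gt0.
have center : pnorm B (xs - xs) <= D by rewrite subrr pnorm0 ltW.
have L0 : 0 <= L := le_trans (opnorm_ge0 hB _) (hL _ ms.1 center).
have Lp0 := ball_Lpsi_ge0 hpsi.
pose m := Num.max 1 X; have m1 : 1 <= m by rewrite le_max lexx.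
have m0 : 0 < m by lra.
have K0 : 0 < K1 by lra.
have g12 : gamma <= 1 / 2.
  by rewrite gE ler_pdivrMr; [rewrite mulrAC ler_pdivlMr; lra | lra].
apply: (total_count_le (b := 16 * (gamma * M) ^+ 2)
  (r := fun j => (pnorm B (v j.+1 - v j) + 5 * scheme_nu Rad j.+1) ^+ 2)
  P1 W1 (lnO_ge1 X) _ _ _ kC) => [|||j jk||].
- by rewrite ln_ge0.
- by lra.
- by apply: mulr_ge0 => //; exact: sqr_ge0.
- have [_ _ it] := run j.+1; have [[s ir] _] := it j (ltnSn j).
  have [Qx _ _] := points j.
  have [_ cnt] := inner_run_spec hB sQ smf cf M0 qsc cp clp psiE Rad0 A00 g0 g1
    Qx ir.
  have u1 : 1 <= K1 * m ^+ 2 by rewrite -[leLHS]mulr1 ler_pM // exprn_ege1.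
  have su : dnorm B s <= scheme_nu Rad j.+1 * (K1 * m ^+ 2).
    apply: le_trans (start_subgrad_le hL hpsi ir) _.
    rewrite gE; apply: (start_ratio_le c0 Rad0 P2 e01 gap0_gt0 L0 Lp0 gF W1) =>
      //.
    + by apply: le_trans kC; rewrite ler_nat.
    + by rewrite ltW // scheme_A_gt0.
    + have k0 : (0 < k)%N by exact: leq_ltn_trans jk.
      apply: (@le_trans _ _ (A k * eps * gap0)).
        by rewrite ler_wpM2r ?(ltW gap0_gt0) // ler_wpM2r ?(ltW e0) // A_mono.
      by rewrite -(prednK k0); apply: A_before_accuracy => //; apply: far;
        rewrite prednK.
  apply: le_trans (cnt _ u1 su) _.
  have -> : ln (K1 * m ^+ 2) = ln K1 + 2 * ln m.
    by rewrite lnM ?posrE ?exprn_gt0 // lnXn // mulr_natl.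
  have := ln_max1_le_lnO X; rewrite -/m; lra.
- have [S _ _] := bounds k.
  apply: (@le_trans _ _ (16 * (gamma * M) ^+ 2 * ((2 * (5 + c) ^+ 2 + 100) *
    Rad ^+ 2))).
    apply: ler_wpM2l; first by apply: mulr_ge0 => //; exact: sqr_ge0.
    apply: (@le_trans _ _ (\sum_(0 <= j < k)
      (2 * pnorm B (v j.+1 - v j) ^+ 2 + 50 * scheme_nu Rad j.+1 ^+ 2))).
      apply: ler_sum => j _.
      by have := sqr_ge0 (pnorm B (v j.+1 - v j) - 5 * scheme_nu Rad j.+1); lra.
    rewrite big_split /= -!mulr_sumr.
    have nu2 := sum_step_sqr_le k (ltW Rad0).
    by rewrite /D in S; rewrite /scheme_nu; lra.
  rewrite -[X in _ <= _ * X]gP; lra.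
- by rewrite mulr_ge0 // addr_ge0 // mulr_ge0 // sqr_ge0.
Qed.

End Complexity.

Theorem theorem6p2 (R : realType) (c : R) (hc : 0 < c) :
  exists C : R, 0 < C /\
  forall (n : nat) (B : 'M[R]_n) (f : 'rV[R]_n -> R)
    (psi : 'rV[R]_n -> \bar R) (M : R) (xs x0 : 'rV[R]_n) (Rad A0 gamma : R),
  let Q := edom psi in
  let F := composite f psi in
  let gap0 := fine (F x0) - fine (F xs) in
  self_adjoint_posdef B ->
  closed_convex_proper psi ->
  convex_function Q f ->
  thrice_differentiable_on Q f ->
  0 < M ->
  quasi_self_concordant B Q M f ->
  is_argmin F xs ->
  Q x0 -> 0 < Rad -> 0 < A0 -> 0 < gamma < 1 ->
  Num.max (pnorm B (x0 - xs)) (2 `^ (3 / 2) / M) <= Rad ->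
  A0 = c ^+ 2 * Rad ^+ 2 / (2 * gap0) ->
  gamma = 1 / (M * Rad) `^ (2 / 3) ->
  scheme_well_defined B f psi M x0 Rad A0 gamma /\
  forall (eps : R) (x v : nat -> 'rV[R]_n) (I : nat -> nat),
  0 < eps < 1 ->
  (forall K, scheme_run B f psi M x0 Rad A0 gamma K x v I) ->
  let reached k := (F (x k) - F xs <= eps%:E * (F x0 - F xs))%E in
  exists k : nat,
    [/\ reached k /\ (forall j, (j < k)%N -> ~ reached j),
        k%:R <= C * ((M * Rad) `^ (2 / 3) * lnO (1 / eps)) &
        forall Lf1 Lpsi0 F0 : R,
          is_Lf1 B f psi xs ((5 + c) * Rad) Lf1 ->
          is_Lpsi0 B psi xs ((5 + c) * Rad) Lpsi0 ->
          is_calF0 B f psi xs ((5 + c) * Rad) F0 ->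
          let calL := lnO ((M * Rad) `^ (2 / 3) * Rad / gap0
                           * (Num.sqrt (Lf1 * F0) + Lpsi0)
                           * (1 / eps * lnO (1 / eps) ^+ 2)) in
          (\sum_(1 <= i < k.+1) I i)%:R
            <= C * ((M * Rad) `^ (2 / 3) * lnO (1 / eps) * calL)].
Proof.
(* kappa bounds the initial overshoot of the gap; C0 is the factor of the
   iteration count, K1 that of the initial ratio of each inner run, and C2
   collects the displacements *)
pose kappa := ((5 + c) / c) ^+ 2; pose C0 := 2 + ln kappa.
pose K1 := (5 + c) ^+ 2 * C0 ^+ 2 * (7 + c).
have kappa1 : 1 <= kappa.
  by rewrite exprn_ege1 // ler_pdivlMr // mul1r; lra.
have C01 : 1 <= C0 by have := ln_ge0 kappa1; rewrite /C0; lra.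
have K11 : 1 <= K1.
  have a1 : 1 <= (5 + c) ^+ 2 by rewrite exprn_ege1 //; lra.
  have b1 : 1 <= C0 ^+ 2 by rewrite exprn_ege1.
  have ab : 1 <= (5 + c) ^+ 2 * C0 ^+ 2 by rewrite -[leLHS]mulr1 ler_pM.
  by rewrite /K1 -[leLHS]mulr1 ler_pM //; lra.
have lK1 := ln_ge0 K11.
pose C2 : R := 16 * (2 * (5 + c) ^+ 2 + 100).
have C20 : 0 <= C2 by have := sqr_ge0 (5 + c); rewrite /C2; lra.
pose C1 := C0 * (6 + 2 * ln K1) + C2.
have C1C0 : C0 <= C1.
  have : C0 * 1 <= C0 * (6 + 2 * ln K1) by rewrite ler_wpM2l //; lra.
  by rewrite /C1; lra.
exists C1; split; first by lra.
move=> n B f psi M xs x0 Rad A0 gamma Q F gap0 hB hpsi hcf smf M0 qsc am Qx0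
  Rad0 A00 /andP[g0 g1] hmax A0E gE.
move: hmax; rewrite ge_max => /andP[x0R MR].
pose p := fine \o psi.
have psiE : extends Q p psi := proper_extends hpsi.
have sQ : segment_closed Q := proper_segment hpsi.
have cf : convex_mod B 0 Q f := convex_function_mod B hcf.
have cp : convex_mod B 0 Q p := proper_convex B hpsi.
have clp : closed_sublevels Q p := proper_closed hpsi.
have FE : extends Q (fun y => f y + p y) F := extends_add f psiE.
have ms := (extends_argmin xs FE).1 am; have [Qxs msle] := ms.
have gap0E : gap0 = (f x0 + p x0) - (f xs + p xs) by rewrite /gap0 !FE.1.
have gap0_ge0 : 0 <= gap0 by rewrite gap0E subr_ge0 msle.
have gap0_gt0 : 0 < gap0.
  rewrite lt_neqAle gap0_ge0 andbT eq_sym; apply/eqP => g00.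
  by move: A00; rewrite A0E g00 mulr0 invr0 mulr0 ltxx.
have A0E' : 2 * A0 * gap0 = c ^+ 2 * Rad ^+ 2.
  by rewrite A0E; field; rewrite gt_eqF.
split.
  exact: scheme_is_well_defined hB sQ smf cf M0 qsc cp clp psiE Rad0 A00 g0 g1
    Qx0.
move=> eps x v I /[dup] e01 /andP[e0 e1] run.
pose P := (M * Rad) `^ (2 / 3).
have P2 : 2 <= P := powR23_ge2 M0 MR.
have gP : (gamma * M) ^+ 2 * Rad ^+ 2 = P.
  have MR0 : 0 <= M * Rad by rewrite mulr_ge0 // ltW.
  have P3 : (M * Rad) ^+ 2 = P ^+ 3 by rewrite /P powR23_cube.
  have -> : (gamma * M) ^+ 2 * Rad ^+ 2 = gamma ^+ 2 * (M * Rad) ^+ 2 by ring.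
  by rewrite P3 gE -/P; field; rewrite gt_eqF //; lra.
have Qx k : Q (x k).
  by have [] := run_points hB sQ smf cf M0 qsc cp clp psiE Rad0 A00 g0 g1 Qx0
    (run k) (leqnn k).
pose gap k := (f (x k) + p (x k)) - (f xs + p xs).
have reachedE k : (F (x k) - F xs <= eps%:E * (F x0 - F xs))%E <->
    gap k <= eps * gap0.
  by rewrite !FE.1 // -!EFinB -EFinM lee_fin gap0E.
rewrite gap0E in gap0_gt0 A0E'.
have decay := gap_decay hB sQ smf cf M0 qsc cp clp psiE Rad0 A00 g0 g1 Qx0 ms hc
  gap0_gt0 A0E' x0R run.
have [k0 k0P k0eps] := iterations_for_accuracy P2 kappa1 e01.
have reach_k0 : gap k0 <= eps * gap0.
  apply: le_trans (decay k0) _; rewrite -gap0E ler_wpM2r //.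
  by rewrite gE -/P.
have exk : exists k, gap k <= eps * gap0 by exists k0.
case: (ex_minnP exk) => k gapk mink.
have kC : k%:R <= C0 * (P * lnO (1 / eps)).
  by apply: le_trans k0P; rewrite ler_nat mink.
have far j : (j < k)%N -> ~ gap j <= eps * gap0.
  by move=> jk /mink; rewrite leqNgt jk.
have PW0 : 0 <= P * lnO (1 / eps).
  by rewrite mulr_ge0 ?(le_trans ler01 (lnO_ge1 _)) //; lra.
exists k; split.
- by split=> [|j jk /reachedE]; [exact/reachedE | exact: far].
- by apply: (le_trans kC); rewrite ler_wpM2r.
move=> Lf1 Lpsi0 F0 [_ ubL] [_ ubP] [_ ubF] /=.
have hL y : Q y -> pnorm B (y - xs) <= (5 + c) * Rad ->
  opnorm B (hess f y) <= Lf1.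
  by move=> Qy yD; apply: ubL; exists y.
have hP y s : Q y -> pnorm B (y - xs) <= (5 + c) * Rad -> subgrad Q p y s ->
    dnorm B s <= Lpsi0.
  move=> Qy yD sy; apply: ubP; exists y, s; split=> //.
  exact/(extends_subdiff _ _ psiE).
have gF : f x0 + p x0 - (f xs + p xs) <= F0.
  apply: ubF; exists x0; last by rewrite -gap0E.
  by split=> //; apply: (le_trans x0R); rewrite ler_peMl ?(ltW Rad0) //; lra.
rewrite gap0E in far.
have := total_inner_iterations hB sQ smf cf M0 qsc cp clp psiE Rad0 A00 g0 g1
  Qx0
  ms hc gap0_gt0 A0E' x0R run P2 gE gP e01 hL hP gF C01 kC far erefl.
by rewrite -gap0E.
Qed.
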